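(* For every pair of integers $i,g\ge 0$ there exists a (nonzero) integer $m=m(g,i)$ which annihilates the torsion subgroup of $\mathrm H_i(X(G);\mathbb Z)$ for every finite quiver $G$ of genus at most $g$, where $X(G)$ denotes the multipath complex of $G$.
   Context: A (finite) quiver $G$ consists of finite sets $V(G)$ (vertices), $E(G)$ (edges) and maps $s,t\colon E(G)\to V(G)$ (source, target). The genus of $G$ is the first Betti number of its geometric realization (the 1-dimensional CW complex with 0-cells the vertices and 1-cells the edges). A simple path in a quiver is a subquiver whose edges can be ordered $e_1,\dots,e_n$ such that $s(e_{i+1})=t(e_i)$ for $i<n$; $s(e_i)=s(e_j)$ or $t(e_i)=t(e_j)$ implies $i=j$; and $s(e_1)\ne t(e_n)$. A multipath of $G$ is a spanning subquiver (same vertex set) each of whose connected components is a single vertex or a simple path. The multipath complex $X(G)$ is the simplicial complex whose simplices are the sets of edges of multipaths of $G$ (the multipath without edges corresponding to the empty simplex). *)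

(* Defs.v *)
From HB Require Import structures.
From mathcomp Require Import all_boot all_order all_algebra.
From mathcomp Require Import boolp.

Set Implicit Arguments.
Unset Strict Implicit.
Unset Printing Implicit Defensive.

Import GRing.Theory Num.Theory.

Local Open Scope ring_scope.

Record simplicial_complex (T : finType) := SimplicialComplex {
  faces : {set {set T}};
  faces0 : set0 \in faces;
  facesS : forall A B : {set T}, B \subset A -> A \in faces -> B \in faces
}.

Record quiver := Quiver {
  vertex : finType;
  edge : finType;
  source : edge -> vertex;
  target : edge -> vertex
}.

(* The geometric realization has no 2-cells, so its first homology is the     *)
(* kernel of the cellular boundary map e |-> target e - source e from 1-chains *)
(* to 0-chains.  Rows are indexed by edges, and kermx is the row kernel.       *)
Definition cellular_boundary (G : quiver) : 'M[rat]_(#|edge G|, #|vertex G|) :=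
  \matrix_(i, j) ((target (enum_val i) == enum_val j)%:R
                  - (source (enum_val i) == enum_val j)%:R).

Definition genus (G : quiver) : nat := \rank (kermx (cellular_boundary G)).

Section Multipaths.
Variable G : quiver.
Implicit Types (p : seq (edge G)) (W : {set vertex G}) (A B : {set edge G}).

Definition is_simple_path_seq p : bool :=
  if p is e :: q then
    [&& path [rel e1 e2 | source e2 == target e1] e q,
        uniq (map (@source G) p), uniq (map (@target G) p)
      & source e != target (last e q)]
  else false.

Definition is_simple_path W B : bool :=
  [exists p : #|B|.-tuple (edge G), ([set e in p] == B) && is_simple_path_seq p]
  && (W == [set source e | e in B] :|: [set target e | e in B]).

(* A spanning subquiver is given by its edge set A. *)
Definition adjacent A : rel (vertex G) := [rel v w | [exists e in A,
  ((source e == v) && (target e == w)) || ((source e == w) && (target e == v))]].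

Definition component_vertices A v : {set vertex G} :=
  [set w | connect (adjacent A) v w].

Definition component_edges A v : {set edge G} :=
  [set e in A | source e \in component_vertices A v].

Definition is_multipath A : bool :=
  [forall v,
    ((component_vertices A v == [set v]) && (component_edges A v == set0))
    || is_simple_path (component_vertices A v) (component_edges A v)].

Lemma adjacent_sym A : symmetric (adjacent A).
Proof. by move=> v w; apply: eq_existsb => e; rewrite orbC. Qed.

Lemma connect_adjacent_sym A : connect_sym (adjacent A).
Proof. exact/sym_connect_sym/adjacent_sym. Qed.

Lemma adjacent_edge A e : e \in A -> adjacent A (source e) (target e).
Proof. by move=> eA; apply/existsP; exists e; rewrite eA !eqxx. Qed.

Lemma adjacentP A v w : adjacent A v w -> exists2 e, e \in A &
  (source e = v /\ target e = w) \/ (source e = w /\ target e = v).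
Proof.
case/existsP=> e /andP[eA /orP[]/andP[/eqP<- /eqP<-]]; exists e => //.
  by left.
by right.
Qed.

Lemma component_target A v e :
  e \in component_edges A v -> target e \in component_vertices A v.
Proof.
rewrite !inE => /andP[eA h]; apply: connect_trans h _.
exact/connect1/adjacent_edge.
Qed.

Lemma component_edgeP A v e : e \in A ->
  (target e \in component_vertices A v) || (source e \in component_vertices A v)
  -> e \in component_edges A v.
Proof.
move=> eA; rewrite !inE eA /= => /orP[] // h; apply: connect_trans h _.
by rewrite connect_adjacent_sym; apply/connect1/adjacent_edge.
Qed.

Lemma component_verticesE A v : component_edges A v != set0 ->
  component_vertices A v =
  [set source e | e in component_edges A v] :|:
  [set target e | e in component_edges A v].
Proof.
case/set0Pn=> e eC; apply/setP=> w; apply/idP/idP; last first.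
  rewrite inE => /orP[]/imsetP[f fC ->]; last exact: component_target.
  by move: fC; rewrite !inE => /andP[].
have se : source e \in component_vertices A v by move: eC; rewrite !inE => /andP[].
move=> wV; have : connect (adjacent A) (source e) w.
  move: se wV; rewrite !inE => h1 h2; apply: connect_trans h2.
  by rewrite connect_adjacent_sym.
case/connectP=> p; case/lastP: p => [_ /= -> |p z].
  by rewrite inE; apply/orP; left; apply: imset_f.
rewrite rcons_path last_rcons => /andP[_ h] wz; subst z.
case/adjacentP: h => f fA [][sf tf].
  have fC : f \in component_edges A v by apply: component_edgeP; rewrite // tf wV.
  by rewrite inE -tf imset_f ?orbT.
have fC : f \in component_edges A v.
  by apply: component_edgeP; rewrite // sf wV orbT.
by rewrite inE -sf imset_f.
Qed.

Lemma component_vertices1 A v : component_edges A v = set0 ->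
  component_vertices A v = [set v].
Proof.
move=> C0; apply/setP=> w; rewrite !inE; apply/idP/eqP => [|->]; last first.
  exact: connect0.
case/connectP=> -[|z p] /=; first by [].
case/andP=> /adjacentP[e eA h] _ _; have : e \in component_edges A v; last by rewrite C0 inE.
by apply: component_edgeP => //; case: h => -[h1 h2]; rewrite !inE ?h1 ?h2 connect0 ?orbT.
Qed.

Lemma simple_path_seqP e0 p : is_simple_path_seq p <->
  [/\ (0 < size p)%N, uniq (map (@source G) p), uniq (map (@target G) p) &
   forall i j, (i < size p)%N -> (j < size p)%N ->
     source (nth e0 p i) = target (nth e0 p j) <-> i = j.+1].
Proof.
have nthU (f : edge G -> vertex G) (q : seq (edge G)) i j : uniq (map f q) -> (i < size q)%N ->
    (j < size q)%N -> f (nth e0 q i) = f (nth e0 q j) -> i = j.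
  move=> uf hi hj h; apply/eqP.
  by rewrite -(nth_uniq (f e0) _ _ uf) ?size_map // !(nth_map e0) // h.
case: p => [|e q]; first by split=> // -[].
set p := e :: q; split=> [/and4P[pp us ut st]|[_ us ut h]].
  have pn i : (i.+1 < size p)%N -> source (nth e0 p i.+1) = target (nth e0 p i).
    by move=> hi; apply/eqP; have /(pathP e0) := pp; apply.
  split=> // i j hi hj; split=> [|ij]; last by subst i; exact: pn.
  case: i hi => [|i] hi h.
    have [hj1|hj1] := ltnP j.+1 (size p).
      by rewrite -pn // in h; have := nthU _ _ _ _ us hi hj1 h.
    move: st; rewrite -[e]/(nth e0 p 0) h; have -> : last e q = nth e0 p j.
      rewrite (last_nth e0) -/p; congr nth; apply/eqP.
      by rewrite eqn_leq -ltnS hj1 -ltnS.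
    by rewrite eqxx.
  by rewrite pn // in h; rewrite (nthU _ _ _ _ ut (ltnW hi) hj h).
apply/and4P; split=> //.
  by apply/(pathP e0) => i hi; apply/eqP/(proj2 (h i.+1 i hi (ltnW hi))).
apply/eqP=> st; have [h0 _] := h 0%N (size q) isT (ltnSn _).
by rewrite (last_nth e0) in st; have := h0 st.
Qed.

Lemma component_simple_pathP A v : component_edges A v != set0 ->
  reflect (exists2 p, p =i component_edges A v & is_simple_path_seq p)
          (is_simple_path (component_vertices A v) (component_edges A v)).
Proof.
move=> C0; rewrite /is_simple_path -component_verticesE // eqxx andbT.
apply: (iffP existsP) => [[p /andP[/eqP h1 h2]]|[p h1 h2]].
  by exists (tval p) => // e; have /setP/(_ e) := h1; rewrite inE.
have up : uniq p by case: (p) h2 => // e q /and4P[_ /map_uniq].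
have sp : size p == #|component_edges A v| by rewrite -(card_uniqP up) (eq_card h1).
by exists (Tuple sp); rewrite h2 andbT; apply/eqP/setP => e; rewrite inE h1.
Qed.

Lemma is_multipath0 : is_multipath set0.
Proof.
apply/forallP=> v; have C0 : component_edges set0 v = set0.
  by apply/setP=> e; rewrite !inE.
by rewrite C0 eqxx component_vertices1 // eqxx.
Qed.

Lemma is_multipathS A B : B \subset A -> is_multipath A -> is_multipath B.
Proof.
move=> sBA mA; apply/forallP=> v.
have [C0|C0] := eqVneq (component_edges B v) set0.
  by rewrite component_vertices1 // eqxx.
apply/orP; right; apply/(component_simple_pathP C0).
have adjS : subrel (connect (adjacent B)) (connect (adjacent A)).
  apply: connect_sub => x y /existsP[e /andP[eB exy]]; apply/connect1/existsP.
  by exists e; rewrite (subsetP sBA) // exy.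
have sCD : component_edges B v \subset component_edges A v.
  apply/subsetP=> e; rewrite !inE => /andP[eB h].
  by rewrite (subsetP sBA) //=; apply: adjS.
case/set0Pn: (C0) => e0 e0C.
have D0 : component_edges A v != set0.
  by apply/set0Pn; exists e0; apply: (subsetP sCD).
move/forallP/(_ v): mA; rewrite (negbTE D0) andbF /=.
case/(component_simple_pathP D0) => p pD sp.
have [p0 us ut h] := iffLR (simple_path_seqP e0 p) sp.
have nthU (f : edge G -> vertex G) i j : uniq (map f p) -> (i < size p)%N ->
    (j < size p)%N -> f (nth e0 p i) = f (nth e0 p j) -> i = j.
  move=> uf hi hj hij; apply/eqP.
  by rewrite -(nth_uniq (f e0) _ _ uf) ?size_map // !(nth_map e0) // hij.
pose C := component_edges B v; pose P i := (i < size p)%N && (nth e0 p i \in C).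
have CP e : e \in C -> P (index e p).
  move=> eC; have ep : e \in p by rewrite pD (subsetP sCD).
  by rewrite /P index_mem ep nth_index.
have exP : exists i, P i by exists (index e0 p); apply: CP.
have ubP i : P i -> (i <= size p)%N by case/andP=> /ltnW.
case: (ex_minnP exP) => a Pa amin; case: (ex_maxnP exP ubP) => b Pb bmax.
have [/andP[bp eb] ab] := (Pb, amin _ Pb).
pose touch (x : vertex G) (e : edge G) := source e = x \/ target e = x.
have touchN x i j : (i < size p)%N -> (j < size p)%N ->
    touch x (nth e0 p i) -> touch x (nth e0 p j) -> (j <= i.+1)%N.
  move=> hi hj [] <- [] hij.
  - by rewrite (nthU _ _ _ us hj hi hij).
  - by rewrite (iffLR (h _ _ hi hj) (esym hij)) leqW.
  - by rewrite (iffLR (h _ _ hj hi) hij).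
  - by rewrite (nthU _ _ _ ut hj hi hij).
have run k : (a <= k)%N -> (k <= b)%N -> P k.
  elim: k => [|k IH]; first by rewrite leqn0 => /eqP a0; rewrite -a0.
  rewrite leq_eqVlt => /orP[/eqP<- //|ak kb]; have Pk := IH ak (ltnW kb).
  have [kp ek] := andP Pk; have k1p : (k.+1 < size p)%N := leq_ltn_trans kb bp.
  have k1B : nth e0 p k.+1 \in B.
    apply/negPn/negP => nB.
    pose S x := exists2 i, (i <= k)%N & touch x (nth e0 p i).
    have Sclosed x y : adjacent B x y -> S x -> S y.
      move=> /adjacentP[f fB hf] [i ik xi].
      have ip : (i < size p)%N := leq_ltn_trans ik (ltnW k1p).
      have [xf yf] : touch x f /\ touch y f.
        by case: hf => -[<- <-]; split; [left | right | right | left].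
      have fp : f \in p.
        have : nth e0 p i \in component_edges A v by rewrite -pD mem_nth.
        rewrite pD => ei; apply: component_edgeP; first exact: (subsetP sBA).
        have xV : x \in component_vertices A v.
          case: xi => <-; last exact: component_target.
          by move: ei; rewrite !inE => /andP[].
        by case: xf => ->; rewrite xV ?orbT.
      have jp : (index f p < size p)%N by rewrite index_mem.
      have jE := nth_index e0 fp; exists (index f p); last by rewrite jE.
      rewrite -ltnS ltn_neqAle; apply/andP; split.
        by apply/eqP => jk; move: nB; rewrite -jk jE fB.
      by apply: leq_trans (touchN x i _ ip jp xi _) _; rewrite ?jE.
    have : S (source (nth e0 p b)).
      have : connect (adjacent B) (source (nth e0 p k)) (source (nth e0 p b)).
        move: ek eb; rewrite !inE => /andP[_ h1] /andP[_ h2].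
        by apply: connect_trans h2; rewrite connect_adjacent_sym.
      have : S (source (nth e0 p k)) by exists k => //; left.
      move: (source (nth e0 p k)) (source (nth e0 p b)) => x y Sx.
      case/connectP=> q hq ->.
      by elim: q x Sx hq => //= z q IHq x Sx /andP[xz]; apply/IHq/(Sclosed x).
    case=> i ik [] hi; have ip : (i < size p)%N := leq_ltn_trans ik (ltnW k1p).
      by have ib := nthU _ _ _ us ip bp hi; rewrite ib leqNgt kb in ik.
    have bi := iffLR (h _ _ bp ip) (esym hi).
    have bk : b = k.+1 by apply/eqP; rewrite eqn_leq kb bi ltnS ik.
    by move: nB eb; rewrite -bk !inE => /negbTE->.
  rewrite /P k1p; apply: component_edgeP => //; apply/orP; right.
  by rewrite (iffRL (h _ _ k1p kp) erefl) component_target.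
pose q := take (b - a).+1 (drop a p).
have [ap _] := andP Pa.
have sq : size q = (b - a).+1.
  by rewrite size_takel // size_drop -subSn // leq_sub2r.
have nq i : (i < size q)%N -> nth e0 q i = nth e0 p (a + i).
  by rewrite sq => iq; rewrite nth_take // nth_drop.
have lt_p i : (i < size q)%N -> (a + i < size p)%N.
  by rewrite sq ltnS => iq; apply: leq_ltn_trans bp; rewrite -(subnKC ab) leq_add2l.
have usub (f : edge G -> vertex G) : uniq (map f p) -> uniq (map f q).
  by rewrite map_take map_drop => /(drop_uniq a) /take_uniq.
exists q.
  move=> e; apply/(nthP e0)/idP => [[i iq <-]|eC].
    rewrite nq //; have /andP[] // : P (a + i)%N.
    by apply: run; rewrite ?leq_addr // -(subnKC ab) leq_add2l -ltnS -sq.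
  have Pe := CP e eC; have [ae eb'] := (amin _ Pe, bmax _ Pe).
  have iq : (index e p - a < size q)%N by rewrite sq ltnS leq_sub2r.
  by exists (index e p - a)%N => //; rewrite nq // subnKC // nth_index // pD (subsetP sCD).
apply/(simple_path_seqP e0); split; [by rewrite sq | exact: usub | exact: usub |].
move=> i j iq jq.
have H := h _ _ (lt_p i iq) (lt_p j jq).
rewrite !nq //; split=> [/(iffLR H)/eqP|ij].
  by rewrite -addnS eqn_add2l => /eqP.
by apply: (iffRL H); rewrite ij addnS.
Qed.

End Multipaths.

Definition multipaths (G : quiver) : {set {set edge G}} := [set A | is_multipath A].

Lemma multipaths0 (G : quiver) : set0 \in multipaths G.
Proof. by rewrite inE is_multipath0. Qed.

Lemma multipathsS (G : quiver) (A B : {set edge G}) :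
  B \subset A -> A \in multipaths G -> B \in multipaths G.
Proof. by move=> sBA; rewrite !inE; apply: is_multipathS. Qed.

Definition multipath_complex (G : quiver) : simplicial_complex (edge G) :=
  SimplicialComplex (multipaths0 G) (@multipathsS G).

(* Unreduced simplicial homology with integer coefficients; simplices are      *)
(* oriented by the enumeration of T.                                           *)
Section Homology.
Variables (T : finType) (X : simplicial_complex T).

Definition simplex (k : nat) :=
  {A : {set T} | (A \in faces X) && (#|A| == k.+1)}.

Definition chain (k : nat) := {ffun simplex k -> int}.

Definition boundary_sign (A : {set T}) (x : T) : int :=
  (-1) ^+ #|[set y in A | (enum_rank y < enum_rank x)%N]|.

(* The coefficient of B collects the terms in which B is A minus a vertex x.   *)
Definition boundary k (c : chain k.+1) : chain k :=
  [ffun B : simplex k => \sum_(A : simplex k.+1)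
     \sum_(x in val A | val A :\ x == val B) boundary_sign (val A) x * c A].

Lemma boundary_is_zmod_morphism k : zmod_morphism (@boundary k).
Proof.
move=> c d; apply/ffunP => B; rewrite !ffunE -sumrB; apply: eq_bigr => A _.
by rewrite -sumrB; apply: eq_bigr => x _; rewrite !ffunE mulrBr.
Qed.

HB.instance Definition _ k := GRing.isZmodMorphism.Build
  (chain k.+1) (chain k) (@boundary k) (@boundary_is_zmod_morphism k).

Lemma boundary_signD1 (A : {set T}) x y : x \in A -> y \in A -> x != y ->
  boundary_sign (A :\ y) x * boundary_sign A y
  = - (boundary_sign (A :\ x) y * boundary_sign A x).
Proof.
wlog lt_xy : x y / (enum_rank x < enum_rank y)%N => [hw xA yA xy|xA yA xy].
  have : enum_rank x != enum_rank y :> nat by rewrite (inj_eq val_inj) (inj_eq enum_rank_inj).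
  rewrite neq_ltn => /orP[h|h]; first exact: hw.
  by rewrite (hw y x) ?opprK // 1?eq_sym.
have -> : boundary_sign (A :\ y) x = boundary_sign A x.
  congr (_ ^+ #|pred_of_set _|); apply/setP=> z; rewrite !inE.
  by have [-> /=|//] := eqVneq z y; rewrite ltnNge (ltnW lt_xy) andbF.
have -> : boundary_sign A y = - boundary_sign (A :\ x) y.
  rewrite /boundary_sign (cardsD1 x) inE xA lt_xy exprS mulN1r; congr (- (_ ^+ #|pred_of_set _|)).
  by apply/setP=> z; rewrite !inE andbA.
by rewrite mulrN mulrC.
Qed.

Lemma boundary_boundary k (c : chain k.+2) : boundary (boundary c) = 0.
Proof.
apply/ffunP=> D; rewrite !ffunE.
pose Q (A : {set T}) x y :=
  [&& y \in A, x \in A, x != y & A :\ y :\ x == val D].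
transitivity (\sum_(A : simplex k.+2) \sum_y \sum_(x | Q (val A) x y)
    boundary_sign (val A :\ y) x * boundary_sign (val A) y * c A); last first.
  apply: big1 => A _; set S := LHS.
  suff : S = - S by move/eqP; rewrite -addr_eq0 -mulr2n mulrn_eq0 => /eqP.
  rewrite {1}/S (exchange_big_dep xpredT) //= /S -sumrN; apply: eq_bigr => x _.
  have QC y : Q (val A) x y = Q (val A) y x.
    by rewrite /Q andbCA eq_sym !setDDl [[set y] :|: _]setUC.
  rewrite (eq_bigl _ _ QC) -sumrN; apply: eq_bigr => y /and4P[xA yA yx _].
  by rewrite -mulNr boundary_signD1 1?eq_sym // opprK.
under eq_bigr => B _ do under eq_bigr => x _ do rewrite ffunE mulr_sumr.
under eq_bigr => B _ do rewrite exchange_big /=.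
rewrite exchange_big /=; apply: eq_bigr => A _.
under eq_bigr => B _ do under eq_bigr => x _ do rewrite mulr_sumr.
under eq_bigr => B _ do rewrite (exchange_big_dep xpredT) //=.
rewrite exchange_big /=; apply: eq_bigr => y _.
have [yA|yA] := boolP (y \in val A); last first.
  rewrite [RHS]big_pred0 => [|x]; last by rewrite /Q (negbTE yA).
  by apply: big1 => B _; apply: big_pred0 => x; rewrite andbF.
have AyX : (val A :\ y \in faces X) && (#|val A :\ y| == k.+2).
  have /andP[AX cA] := valP A; rewrite (facesS (subD1set _ _) AX) /=.
  by rewrite (cardsD1 y) yA in cA.
rewrite (bigD1 (Sub (val A :\ y) AyX : simplex k.+1)) //= [X in _ + X]big1 ?addr0.
  apply: eq_big => [x|x _]; last by rewrite mulrA.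
  rewrite /Q yA eqxx andbT !inE. by case: (x != y); case: (x \in _).
move=> B neB; apply: big_pred0 => x; apply/negP => /andP[_ /eqP AyB].
by case/eqP: neB; apply: val_inj; rewrite /= AyB.
Qed.

Definition is_cycle k : chain k -> bool :=
  if k is j.+1 then fun c => boundary c == 0 else fun=> true.

Lemma is_cycle_zmod_closed k : zmod_closed (@is_cycle k).
Proof.
case: k => [|k] //; split=> [|c d]; rewrite !unfold_in /= ?raddf0 //.
by move=> /eqP hc /eqP hd; rewrite raddfB /= hc hd subrr.
Qed.

HB.instance Definition _ k :=
  GRing.isZmodClosed.Build (chain k) (@is_cycle k) (@is_cycle_zmod_closed k).

Record cycles k := Cycle { cycle_chain :> chain k; _ : is_cycle cycle_chain }.
HB.instance Definition _ k := [isSub for @cycle_chain k].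
HB.instance Definition _ k := [Choice of cycles k by <:].
HB.instance Definition _ k := [SubChoice_isSubZmodule of cycles k by <:].

Definition is_boundary k (z : cycles k) : bool :=
  `[< exists c : chain k.+1, boundary c = z :> chain k >].

Lemma is_boundary_zmod_closed k : zmod_closed (@is_boundary k).
Proof.
split=> [|y z]; rewrite !unfold_in; first by apply/asboolP; exists 0; rewrite raddf0.
move=> /asboolP[c hc] /asboolP[d hd]; apply/asboolP; exists (c - d).
by rewrite raddfB /= hc hd.
Qed.

HB.instance Definition _ k :=
  GRing.isZmodClosed.Build (cycles k) (@is_boundary k) (@is_boundary_zmod_closed k).

Definition boundaries k : zmodClosed (cycles k) :=
  GRing.ZmodClosed.clone _ (@is_boundary k) _.

Definition homology k : zmodType := Quotient.quot (boundaries k).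

End Homology.

Definition is_torsion (M : zmodType) (x : M) : Prop :=
  exists2 n : nat, (0 < n)%N & x *+ n = 0.

(* Main.v *)
Require Import Defs.
From HB Require Import structures.
From mathcomp Require Import all_boot all_order all_algebra.
From mathcomp Require Import boolp zify ring.

(* Splitting each vertex of G into an out-vertex and an in-vertex turns G into *)
(* a bipartite graph whose matchings are the edge sets that can fail to be     *)
(* multipaths only by containing a directed cycle. In homological degree i     *)
(* only cycles with at most i + 2 edges are visible, and genus <= g leaves at  *)
(* most 2 ^ g cycles. So it suffices to bound torsion for complexes of         *)
(* matchings of a graph with |A| <= |V(A)| + g for every edge set A, subject   *)
(* to arbitrary further constraints on a set D of at most M edges.             *)
(* Induct on the degree. If an edge outside D has pairwise incident neighbours *)
(* (for instance if it ends at a leaf), the homology is the direct sum of the  *)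
(* homologies of the links of these neighbours, in one degree less. If three   *)
(* consecutive edges outside D meet at vertices of degree 2, they can be       *)
(* contracted to a point, again lowering the degree by one. Otherwise          *)
(* a degree count bounds the number of edges by 6 g + 11 M, and finitely many  *)
(* boundary matrices remain.                                                   *)

Set Implicit Arguments.
Unset Strict Implicit.
Unset Printing Implicit Defensive.

Import GRing.Theory Num.Theory.

Local Open Scope ring_scope.

(** * The simplicial boundary as a sum of contraction operators *)

(** All chains live in the exterior algebra on [T], where the augmented boundary [bd] is the sum of
    the contractions. Since a cycle z is the boundary of [wedge x z] ([bd_wedge]), a class can be
    killed by coning whenever a suitable apex exists. [torsion_bound] is a statement about the
    torsion of the cokernel of [bd], which agrees with that of homology.

    The induction needs a class of complexes stable under both reductions, with parameters [g] and
    [M] that do not grow. [graph_complex] is such a class: it is inherited by links of edges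
    ([link_graph_complex]) and by the contraction of three consecutive edges ([path_graph_complex]).
    [torsion_bound_cone] and [torsion_bound_path] show that neither reduction worsens the constant.
    When neither applies, [exists_reducible_edge] bounds the number of edges, and
    [torsion_bound_bounded] gives one constant for all such small complexes.
    [torsion_bound_graph_complex] combines these, so the constant depends only on the degree, [g]
    and [M].

    Quivers enter through [multipathP]: multipaths are the edge sets with injective source and
    target maps that contain no circulation. The genus supplies both the sparsity ([genus_sparse])
    and the bound on the number of circulations ([card_circulations]). *)

Section ExteriorOperators.
Variable T : finType.
Local Notation ch := {ffun {set T} -> int}.
Implicit Types (x y : T) (B : {set T}) (c : ch).

(** Interior product with the generator [x]; [wedge] is left exterior multiplication by [x]. Chains
    are functions on all subsets, so that both are total operators; support conditions are imposed
    separately by [chain_in]. *)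
Definition contr x c : ch :=
  [ffun B : {set T} => if x \in B then 0 else boundary_sign B x * c (x |: B)].

Definition wedge x c : ch :=
  [ffun B : {set T} => if x \in B then boundary_sign B x * c (B :\ x) else 0].

Definition bd c : ch := \sum_x contr x c.

Lemma contr_is_zmod_morphism x : zmod_morphism (contr x).
Proof.
by move=> c d; apply/ffunP=> B; rewrite !ffunE; case: ifP; rewrite ?subrr // mulrBr.
Qed.
HB.instance Definition _ x :=
  GRing.isZmodMorphism.Build ch ch (contr x) (contr_is_zmod_morphism x).

Lemma wedge_is_zmod_morphism x : zmod_morphism (wedge x).
Proof.
by move=> c d; apply/ffunP=> B; rewrite !ffunE; case: ifP; rewrite ?subrr // mulrBr.
Qed.
HB.instance Definition _ x :=
  GRing.isZmodMorphism.Build ch ch (wedge x) (wedge_is_zmod_morphism x).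

Lemma bd_is_zmod_morphism : zmod_morphism bd.
Proof. by move=> c d; rewrite /bd -sumrB; apply: eq_bigr => x _; rewrite raddfB. Qed.
HB.instance Definition _ :=
  GRing.isZmodMorphism.Build ch ch bd bd_is_zmod_morphism.

Lemma boundary_sign_sqr B x : boundary_sign B x * boundary_sign B x = 1.
Proof. by rewrite /boundary_sign -expr2 sqrr_sign. Qed.

Definition rank_sign x y : int := (-1) ^+ (enum_rank x < enum_rank y)%N.

Lemma boundary_signU1 B x y : x \notin B ->
  boundary_sign (x |: B) y =
  rank_sign x y * boundary_sign B y.
Proof.
move=> xB; rewrite /boundary_sign /rank_sign -exprD; congr (_ ^+ _).
rewrite (cardsD1 x) !inE eqxx /=; congr (_ + _)%N.
apply: eq_card => z; rewrite !inE.
by have [->|] := eqVneq z x; rewrite ?(negbTE xB).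
Qed.

Lemma rank_signC x y : x != y -> rank_sign x y = - rank_sign y x.
Proof.
move=> xy; have : enum_rank x != enum_rank y :> nat.
  by rewrite (inj_eq val_inj) (inj_eq enum_rank_inj).
by rewrite /rank_sign; case: ltngtP => //= _ _; rewrite ?opprK.
Qed.

Lemma rank_sign_sqr x y : rank_sign x y * rank_sign x y = 1.
Proof. by rewrite /rank_sign -expr2 sqrr_sign. Qed.

Lemma boundary_sign_setD1 B x : boundary_sign (B :\ x) x = boundary_sign B x.
Proof.
rewrite /boundary_sign; congr (_ ^+ _); apply: eq_card => z; rewrite !inE.
by have [->|] := eqVneq z x; rewrite ?ltnn ?andbF.
Qed.

Lemma contr_anticomm x y c : contr x (contr y c) = - contr y (contr x c).
Proof.
apply/ffunP=> B; rewrite !ffunE.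
have [<-|xy] := eqVneq x y; first by rewrite !inE eqxx /= mulr0 if_same oppr0.
rewrite !inE (negbTE xy) eq_sym (negbTE xy) /=.
case: ifP => xB; case: ifP => yB; rewrite ?mulr0 ?oppr0 //.
rewrite setUCA !boundary_signU1 ?xB ?yB // (rank_signC xy); ring.
Qed.

Lemma contr_wedge_neq x y c : x != y -> contr x (wedge y c) = - wedge y (contr x c).
Proof.
move=> xy; apply/ffunP=> B; rewrite !ffunE.
rewrite !inE (negbTE xy) eq_sym (negbTE xy) /=.
case: ifP => xB; case: ifP => yB; rewrite ?mulr0 ?oppr0 //.
have -> : (x |: B) :\ y = x |: (B :\ y).
  apply/setP=> z; rewrite !inE; have [->|] := eqVneq z x => //=.
  by rewrite xy.
have -> : boundary_sign B x = rank_sign y x * boundary_sign (B :\ y) x.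
  by rewrite -boundary_signU1 ?setD1K // !inE eqxx.
rewrite !boundary_signU1 ?xB // (rank_signC xy); set r := rank_sign y x.
transitivity (- (r * r) * boundary_sign (B :\ y) x * boundary_sign B y * c (x |: (B :\ y))).
  by ring.
by rewrite rank_sign_sqr; ring.
Qed.

Lemma contr_wedge x c : contr x (wedge x c) = c - wedge x (contr x c).
Proof.
apply/ffunP=> B; rewrite !ffunE !inE eqxx /=; case: ifP => xB.
  by rewrite setD1K // mulrA boundary_sign_setD1 boundary_sign_sqr mul1r subrr.
rewrite subr0 mulrA setU1K ?xB // -(boundary_sign_setD1 (x |: B)) setU1K ?xB //.
by rewrite boundary_sign_sqr mul1r.
Qed.

Lemma bd_contr x c : bd (contr x c) = - contr x (bd c).
Proof.
by rewrite /bd raddf_sum -sumrN; apply: eq_bigr => y _; rewrite contr_anticomm.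
Qed.

(** The contracting homotopy of a cone with apex [x]. *)
Lemma bd_wedge x c : bd (wedge x c) = c - wedge x (bd c).
Proof.
rewrite /bd raddf_sum /= (bigD1 x) //= contr_wedge [in RHS](bigD1 x) //= opprD addrA.
congr (_ + _); rewrite -sumrN; apply: eq_bigr => y yx.
by rewrite contr_wedge_neq.
Qed.

Lemma chain_mulrn_inj c k : (0 < k)%N -> c *+ k = 0 -> c = 0.
Proof.
move=> k0 /ffunP h; apply/ffunP=> B; move: (h B).
by rewrite ffunMnE !ffunE => /eqP; rewrite mulrn_eq0 eqn0Ngt k0 => /eqP.
Qed.

Lemma bd_bd c : bd (bd c) = 0.
Proof.
have : bd (bd c) = - bd (bd c).
  rewrite {1}/bd (eq_bigr (fun x => - bd (contr x c))) => [|x _].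
    by rewrite sumrN -raddf_sum.
  by rewrite bd_contr opprK.
by move/eqP; rewrite -addr_eq0 -mulr2n => /eqP/chain_mulrn_inj ->.
Qed.

Definition chain_in (S : {set {set T}}) c := forall B, c B != 0 -> B \in S.

Section ChainIn.
Variable S : {set {set T}}.

Lemma chain_in_eq0 c B : chain_in S c -> B \notin S -> c B = 0.
Proof. by move=> h BS; apply/eqP; apply: contraNT BS; apply: h. Qed.

Lemma chain_inP c : (forall B, B \notin S -> c B = 0) -> chain_in S c.
Proof. by move=> h B; apply: contraNT => /h ->. Qed.

Lemma chain_in0 : chain_in S 0.
Proof. by apply: chain_inP => B _; rewrite ffunE. Qed.

Lemma chain_inD c d : chain_in S c -> chain_in S d -> chain_in S (c + d).
Proof.
move=> hc hd; apply: chain_inP => B BS.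
by rewrite ffunE (chain_in_eq0 hc) // (chain_in_eq0 hd) // addr0.
Qed.

Lemma chain_inN c : chain_in S c -> chain_in S (- c).
Proof. by move=> h; apply: chain_inP => B BS; rewrite ffunE (chain_in_eq0 h) // oppr0. Qed.

Lemma chain_inB c d : chain_in S c -> chain_in S d -> chain_in S (c - d).
Proof. by move=> hc hd; apply: chain_inD => //; apply: chain_inN. Qed.

Lemma chain_inMn c n : chain_in S c -> chain_in S (c *+ n).
Proof.
move=> h; elim: n => [|n IH]; first exact: chain_in0.
by rewrite mulrS; apply: chain_inD.
Qed.

Lemma chain_in_sum (I : finType) (P : pred I) (F : I -> ch) :
  (forall i, P i -> chain_in S (F i)) -> chain_in S (\sum_(i | P i) F i).
Proof. by move=> h; apply: big_ind => //; [apply: chain_in0 | apply: chain_inD]. Qed.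

End ChainIn.

Lemma chain_in_contr (S S' : {set {set T}}) x c :
    (forall B, x \notin B -> x |: B \in S -> B \in S') ->
  chain_in S c -> chain_in S' (contr x c).
Proof.
move=> h hc B; rewrite ffunE; case: ifPn => [|xB]; first by rewrite eqxx.
by rewrite mulf_eq0 negb_or => /andP[_ /hc]; apply: h.
Qed.

Lemma chain_in_wedge (S S' : {set {set T}}) x c :
    (forall B, x \notin B -> B \in S -> x |: B \in S') ->
  chain_in S c -> chain_in S' (wedge x c).
Proof.
move=> h hc B; rewrite ffunE; case: ifPn => [xB|]; last by rewrite eqxx.
rewrite mulf_eq0 negb_or => /andP[_ /hc hB].
by rewrite -(setD1K xB); apply: h => //; rewrite !inE eqxx.
Qed.

(* Chains are graded by the cardinality of faces, so the dimension is n - 1 and  *)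
(* the empty face spans layer 0.                                                *)
Definition layer (K : {set {set T}}) n := [set B in K | #|B| == n].

(* Chains modulo cycles are torsion-free, so the torsion of the cokernel of bd  *)
(* is that of the homology, and cycles need not be mentioned.                   *)
Definition torsion_bound (K : {set {set T}}) n m :=
  forall c b k, (0 < k)%N -> chain_in (layer K n) c -> chain_in (layer K n.+1) b ->
  bd b = c *+ k -> exists2 b', chain_in (layer K n.+1) b' & bd b' = c *+ m.

Lemma torsion_bound_dvd K n m m' : (m %| m')%N ->
  torsion_bound K n m -> torsion_bound K n m'.
Proof.
move=> /dvdnP[q ->] h c b k k0 hc hb e; have [b' hb' e'] := h c b k k0 hc hb e.
by exists (b' *+ q); [apply: chain_inMn | rewrite raddfMn /= e' mulnC mulrnA].
Qed.

Lemma bd_torsion0 c b k : (0 < k)%N -> bd b = c *+ k -> bd c = 0.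
Proof. by move=> k0 e; apply: (chain_mulrn_inj k0); rewrite -raddfMn /= -e bd_bd. Qed.

End ExteriorOperators.

(** * Two reductions lowering the homological degree *)

Definition down_closed (T : finType) (K : {set {set T}}) :=
  forall A B : {set T}, B \subset A -> A \in K -> B \in K.

Definition link (T : finType) (K : {set {set T}}) (f : T) : {set {set T}} :=
  [set B : {set T} | (f \notin B) && (f |: B \in K)].

Section Reductions.
Variables (T : finType) (K : {set {set T}}).
Hypothesis Kdown : down_closed K.
Local Notation ch := {ffun {set T} -> int}.

Lemma link_down_closed f : down_closed (link K f).
Proof.
move=> A B sBA; rewrite !inE => /andP[fA AK]; apply/andP; split.
  by apply: contra fA; apply: (subsetP sBA).
by apply: Kdown AK; apply: setUS.
Qed.

Lemma wedge_contrE x (c : ch) B : wedge x (contr x c) B = if x \in B then c B else 0.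
Proof.
rewrite !ffunE; case: ifP => // xB.
by rewrite !inE eqxx /= setD1K // mulrA boundary_sign_setD1 boundary_sign_sqr mul1r.
Qed.

(** Only the empty face has cardinality 0. The augmentation is onto as soon as there is a vertex and
    zero otherwise, so its cokernel has no torsion. *)
Lemma torsion_bound0 : torsion_bound K 0 1.
Proof.
move=> c b k k0 hc hb e; have dc := bd_torsion0 k0 e.
have [b0|] := boolP [forall B, b B == 0].
  exists 0; first exact: chain_in0.
  have -> : c = 0.
    apply: (chain_mulrn_inj k0); rewrite -e.
    suff -> : b = 0 by rewrite raddf0.
    by apply/ffunP=> B; rewrite ffunE; apply/eqP/(forallP b0).
  by rewrite mul0rn raddf0.
rewrite negb_forall => /existsP[A /hb]; rewrite inE => /andP[AK /cards1P[x Ax]].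
exists (wedge x c); last by rewrite bd_wedge dc raddf0 subr0.
apply: chain_in_wedge hc => B xB; rewrite !inE => /andP[BK /eqP/cards0_eq ->].
by rewrite setU0 -Ax AK Ax cards1.
Qed.

Lemma chain_in_link f n (c : ch) :
  chain_in (layer K n.+1) c -> chain_in (layer (link K f) n) (contr f c).
Proof.
by apply: chain_in_contr => B fB; rewrite !inE fB cardsU1 fB add1n eqSS.
Qed.

(** A face contains at most one element of [F], so modulo the faces missing [F] a chain splits into
    its parts in the links of the elements of [F]. The faces missing [F] lie in a cone with apex [a]
    and contribute nothing. *)
Lemma torsion_bound_cone n m (F : {set T}) a :
    (forall B f g, B \in K -> f \in F -> g \in F -> f \in B -> g \in B -> f = g) ->
    (forall B, B \in K -> [disjoint B & F] -> a |: B \in K) ->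
    (forall f, f \in F -> torsion_bound (link K f) n m) ->
  torsion_bound K n.+1 m.
Proof.
move=> F1 aK hm c b k k0 hc hb e; have dc := bd_torsion0 k0 e.
have /fin_all_exists[w hw] : forall f, exists u : ch, f \in F ->
    chain_in (layer (link K f) n.+1) u /\ bd u = contr f c *+ m.
  move=> f; have [fF|] := boolP (f \in F); last by exists 0.
  have eb : bd (- contr f b) = contr f c *+ k.
    by rewrite raddfN /= bd_contr opprK e raddfMn.
  have [u hu eu] := hm f fF _ _ k k0 (chain_in_link hc)
    (chain_inN (chain_in_link hb)) eb.
  by exists u.
(* Filling the link parts of [c *+ m] and subtracting the boundary leaves a cycle supported away
   from [F], to be coned off from [a]. *)
pose b1 := - \sum_(f in F) wedge f (w f).
have hb1 : chain_in (layer K n.+2) b1.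
  apply: chain_inN; apply: chain_in_sum => f /hw[h _].
  apply: chain_in_wedge h => B fB; rewrite !inE => /andP[/andP[_ ->]].
  by rewrite cardsU1 fB add1n eqSS.
pose S := [set B in layer K n.+1 | [disjoint B & F]].
have e1 : c *+ m - bd b1 = (c - \sum_(f in F) wedge f (contr f c)) *+ m + \sum_(f in F) w f.
  rewrite raddfN opprK raddf_sum /=.
  rewrite (eq_bigr (fun f => w f - wedge f (contr f c) *+ m)) => [|f /hw[_ ef]].
    by rewrite sumrB mulrnBl -sumrMnl -addrA; congr (_ + _); rewrite addrC.
  by rewrite bd_wedge ef raddfMn.
have hS : chain_in S (c *+ m - bd b1).
  rewrite e1; apply: chain_inD.
    apply: chain_inMn => B; rewrite inE !ffunE sum_ffunE.
    under eq_bigr => f _ do rewrite wedge_contrE.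
    have [BL|BL] := boolP (B \in layer K n.+1); last first.
      rewrite (chain_in_eq0 hc BL) big1 ?subr0 ?eqxx // => f _.
      by rewrite if_same.
    have [//|/pred0Pn[f /= /andP[fB fF]]] := boolP [disjoint B & F].
    rewrite (bigD1 f) //= fB big1 ?addr0 ?subrr ?eqxx // => g /andP[gF gf].
    case: ifP => // gB; case/eqP: gf; apply: (F1 B) => //.
    by move: BL; rewrite inE => /andP[].
  apply: chain_in_sum => f fF; have [h _] := hw f fF.
  move=> B /h; rewrite !inE => /andP[/andP[fB fBK] ->].
  rewrite (Kdown (subsetUr _ _) fBK) /=.
  rewrite disjoint_subset; apply/subsetP=> g gB; apply/negP => gF.
  have fg : f = g by apply: (F1 _ _ _ fBK fF gF); rewrite !inE ?eqxx ?gB ?orbT.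
  by rewrite fg gB in fB.
exists (b1 + wedge a (c *+ m - bd b1)).
  apply: chain_inD => //; apply: chain_in_wedge hS => B aB.
  by rewrite !inE cardsU1 aB add1n eqSS => /andP[/andP[BK ->] /(aK _ BK) ->].
rewrite raddfD /= bd_wedge raddfB /= raddfMn /= dc mul0rn bd_bd subr0 raddf0 subr0.
by rewrite addrC subrK.
Qed.

End Reductions.

(** * Contracting a path of three edges: a suspension *)

Section PathReduction.
Variable T : finType.
Local Notation ch := {ffun {set T} -> int}.
Implicit Types (x : T) (c : ch) (B : {set T}).

Lemma contr_free (S : {set {set T}}) x c :
  (forall B, B \in S -> x \notin B) -> chain_in S c -> contr x c = 0.
Proof.
move=> h hc; apply/ffunP=> B; rewrite !ffunE; case: ifPn => // _.
rewrite (chain_in_eq0 hc) ?mulr0 //; apply/negP => /h.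
by rewrite !inE eqxx.
Qed.

Lemma wedge_wedge x c : wedge x (wedge x c) = 0.
Proof. by apply/ffunP=> B; rewrite !ffunE !inE eqxx /= mulr0 if_same. Qed.

Lemma contr_wedgeE x c B : contr x (wedge x c) B = if x \in B then 0 else c B.
Proof.
rewrite contr_wedge ffunE [X in _ + X]ffunE wedge_contrE.
by case: ifP; rewrite ?subrr ?subr0.
Qed.

Lemma contr_neq0 x c B : x \in B -> c B != 0 -> contr x c (B :\ x) != 0.
Proof.
move=> xB; rewrite ffunE !inE eqxx /= setD1K // mulf_eq0 => /negbTE->.
by rewrite orbF /boundary_sign signr_eq0.
Qed.

Lemma chain_in_contr_wedge (S : {set {set T}}) x c :
  chain_in S c -> chain_in [set B in S | x \notin B] (contr x (wedge x c)).
Proof.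
move=> hc B; rewrite contr_wedgeE inE; case: ifP => _; first by rewrite eqxx.
by move/hc ->.
Qed.

(** [contr x (wedge x _)] restricts a chain to the faces missing [x]; the first term on the right
    measures its failure to anticommute with [bd] after a contraction. *)
Lemma bd_contr_wedge x y c : bd (contr x (wedge x (contr y c))) =
  - contr x (contr y c) - contr x (wedge x (contr y (bd c))).
Proof.
by rewrite bd_contr bd_wedge bd_contr raddfN opprK raddfD opprD.
Qed.

Lemma chain_in_bd (K : {set {set T}}) n c : down_closed K ->
  chain_in (layer K n.+1) c -> chain_in (layer K n) (bd c).
Proof.
move=> Kdown hc; apply: chain_in_sum => x _; apply: chain_in_contr hc => B xB.
rewrite !inE cardsU1 xB add1n eqSS => /andP[BK ->].
by rewrite (Kdown _ _ (subsetUr _ _) BK).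
Qed.

Lemma disjoint_setU1 x B B' : [disjoint x |: B & B'] = (x \notin B') && [disjoint B & B'].
Proof. by rewrite -[RHS]disjointU1; apply: eq_disjoint => z; rewrite !inE. Qed.

Section Reduction.
Variables (K : {set {set T}}) (a b c : T) (P Q : {set T}).
Hypothesis Kdown : down_closed K.
Hypotheses (ac : a != c) (cP : c \notin P).
Hypothesis Ka : forall B, B \in K -> a \in B -> b \notin B /\ [disjoint B & P].
Hypothesis Kc : forall B, B \in K -> c \in B -> b \notin B /\ [disjoint B & Q].
Hypothesis aK : forall B, B \in K -> b \notin B -> [disjoint B & P] -> a |: B \in K.
Hypothesis cK : forall B, B \in K -> b \notin B -> [disjoint B & Q] -> c |: B \in K.
Hypothesis bK : forall B, B \in K -> a \notin B -> c \notin B -> b |: B \in K.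

(** [K] is the union of a cone with apex [b], formed by the faces missing [a] and [c], and of the
    stars of [a] and [c], whose union is contractible. This complex is the intersection of the two
    pieces, so [K] has the homology of its suspension. *)
Definition path_contraction := [set B in K |
  [&& a \notin B, b \notin B, c \notin B & [disjoint B & P] || [disjoint B & Q]]].

(* Modulo the cone with apex b, a chain is determined by its a-part and its   *)
(* c-part; their sum is the comparison map of the Mayer-Vietoris sequence of   *)
(* path_contraction covered by the faces missing P and the faces missing Q.    *)
Let phi z : ch := contr c (wedge c (contr a z)) + contr a (wedge a (contr c z)).

Let phiD : {morph phi : z w / z + w}.
Proof. by move=> z w; rewrite /phi !raddfD addrACA. Qed.

Let phiMn z n : phi (z *+ n) = phi z *+ n.
Proof. by rewrite /phi !raddfMn mulrnDl. Qed.

Let bd_phi z : bd (phi z) = - phi (bd z).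
Proof.
rewrite /phi raddfD /= !bd_contr_wedge (contr_anticomm a c) opprK addrACA.
by rewrite addNr add0r opprD.
Qed.

Let contr_a_in n z : chain_in (layer K n.+1) z ->
  chain_in [set B in layer path_contraction n | [disjoint B & P]]
    (contr c (wedge c (contr a z))).
Proof.
pose S := [set B : {set T} | [&& a |: B \in K, a \notin B & #|B| == n]].
move=> hz; have h : chain_in S (contr a z).
  by apply: chain_in_contr hz => B aB; rewrite !inE aB cardsU1 aB add1n eqSS.
move=> B /(chain_in_contr_wedge h); rewrite !inE => /andP[/and3P[aBK aB ->] cB].
have [bB dB] := Ka aBK (setU11 _ _).
rewrite aB cB (Kdown (subsetUr _ _) aBK) /= andbT.
move: bB; rewrite !inE negb_or => /andP[_ ->] /=.
by have -> : [disjoint B & P] by apply: disjointWl dB; apply: subsetUr.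
Qed.

Let contr_c_in n z : chain_in (layer K n.+1) z ->
  chain_in [set B in layer path_contraction n | [disjoint B & Q]]
    (contr a (wedge a (contr c z))).
Proof.
pose S := [set B : {set T} | [&& c |: B \in K, c \notin B & #|B| == n]].
move=> hz; have h : chain_in S (contr c z).
  by apply: chain_in_contr hz => B cB; rewrite !inE cB cardsU1 cB add1n eqSS.
move=> B /(chain_in_contr_wedge h); rewrite !inE => /andP[/and3P[cBK cB ->] aB].
have [bB dB] := Kc cBK (setU11 _ _).
rewrite aB cB (Kdown (subsetUr _ _) cBK) /= andbT.
move: bB; rewrite !inE negb_or => /andP[_ ->] /=.
by have -> : [disjoint B & Q] by [apply: disjointWl dB; apply: subsetUr]; rewrite orbT.
Qed.

Let free_a n y : chain_in (layer path_contraction n) y -> contr a y = 0.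
Proof. by apply: contr_free => B; rewrite !inE => /andP[/and3P[]]. Qed.

Let free_c n y : chain_in (layer path_contraction n) y -> contr c y = 0.
Proof. by apply: contr_free => B; rewrite !inE => /andP[/and5P[]]. Qed.

Lemma torsion_bound_path n m :
  torsion_bound path_contraction n m -> torsion_bound K n.+1 m.
Proof.
move=> hm z w k k0 hz hw e; have dz := bd_torsion0 k0 e.
have ca : c != a by rewrite eq_sym.
have sub1 n' (R : {set T}) y :
    chain_in [set B in layer path_contraction n' | [disjoint B & R]] y ->
    chain_in (layer path_contraction n') y.
  by move=> h B /h; rewrite inE => /andP[].
have phi_in n' u : chain_in (layer K n'.+1) u ->
    chain_in (layer path_contraction n') (phi u).
  by move=> hu; apply: chain_inD; apply: sub1; [apply: contr_a_in | apply: contr_c_in].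
have [y hy ey] : exists2 y, chain_in (layer path_contraction n.+1) y & bd y = phi z *+ m.
  have := hm (phi z) (- phi w) k k0 (phi_in _ _ hz) (chain_inN (phi_in _ _ hw)).
  by apply; rewrite raddfN /= bd_phi opprK e phiMn.
(* Each face of the contraction misses [P] or [Q]; accordingly [y] splits into a part that can be
   joined to [a] and one that can be joined to [c], which lifts it along [phi]. *)
pose y1 : ch := [ffun B : {set T} => if [disjoint B & P] then y B else 0].
pose y2 := y - y1.
have hy1 : chain_in [set B in layer path_contraction n.+1 | [disjoint B & P]] y1.
  by move=> B; rewrite inE ffunE; case: ifP => [_ /hy ->|]; rewrite ?eqxx.
have hy2 : chain_in [set B in layer path_contraction n.+1 | [disjoint B & Q]] y2.
  move=> B; rewrite inE !ffunE; case: ifP => dB; first by rewrite subrr eqxx.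
  by rewrite subr0 => /hy BL; rewrite BL; move: BL; rewrite !inE dB /= => /andP[/and5P[]].
have [a1 c1] := (free_a (sub1 _ _ _ hy1), free_c (sub1 _ _ _ hy1)).
have [a2 c2] := (free_a (sub1 _ _ _ hy2), free_c (sub1 _ _ _ hy2)).
pose v := wedge a y1 + wedge c y2.
have hv : chain_in (layer K n.+2) v.
  apply: chain_inD.
    apply: chain_in_wedge hy1 => B aB; rewrite !inE cardsU1 aB add1n eqSS.
    by case/andP=> /andP[/and5P[BK _ bB _ _] ->] dB; rewrite aK.
  apply: chain_in_wedge hy2 => B cB; rewrite !inE cardsU1 cB add1n eqSS.
  by case/andP=> /andP[/and5P[BK _ bB _ _] ->] dB; rewrite cK.
have phiv : phi v = y.
  have cw x u : contr x u = 0 -> contr x (wedge x u) = u.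
    by move=> u0; rewrite contr_wedge u0 raddf0 subr0.
  rewrite /v phiD /phi (cw a y1 a1) (cw c y1 c1) (cw c y2 c2) (cw a y2 a2).
  rewrite (contr_wedge_neq _ ca) (contr_wedge_neq _ ac) c1 a2 !(raddf0, oppr0).
  by rewrite addr0 add0r /y2 addrC subrK.
pose z1 := z *+ m + bd v.
have hz1 : chain_in (layer K n.+1) z1.
  by apply: chain_inD; [apply: chain_inMn | apply: chain_in_bd].
have dz1 : bd z1 = 0 by rewrite raddfD /= raddfMn /= dz mul0rn bd_bd addr0.
have phiz1 : phi z1 = 0.
  by rewrite phiD phiMn -[phi (bd v)]opprK -bd_phi phiv ey subrr.
(* As [phi z1 = 0], the [a]-part and the [c]-part of [z1] are opposite, so [p] misses both [P] and
   [Q] and can be joined to [a] and [c] at once. The boundary of that join cancels both parts. *)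
pose p := contr c (wedge c (contr a z1)).
have hp := contr_a_in hz1; rewrite -/p in hp.
have hpQ : chain_in [set B in layer path_contraction n | [disjoint B & Q]] p.
  have -> : p = - contr a (wedge a (contr c z1)) by apply/eqP; rewrite -addr_eq0; apply/eqP.
  by apply: chain_inN; apply: contr_c_in.
have [ap cp] := (free_a (sub1 _ _ _ hp), free_c (sub1 _ _ _ hp)).
pose v2 := wedge a (wedge c p).
have hv2 : chain_in (layer K n.+2) v2.
  pose S := [set B in layer K n.+1 | (b \notin B) && [disjoint B & P]].
  apply: (@chain_in_wedge _ S).
    move=> B aB; rewrite !inE cardsU1 aB add1n eqSS.
    by case/andP=> /andP[BK ->] /andP[bB dB]; rewrite aK.
  pose S' := [set B in layer path_contraction n | [disjoint B & P] && [disjoint B & Q]].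
  have hp' : chain_in S' p.
    move=> B pB; move: (hp _ pB) (hpQ _ pB); rewrite !inE => /andP[-> ->].
    by case/andP=> _ ->.
  apply: chain_in_wedge hp' => B cB; rewrite !inE cardsU1 cB add1n eqSS.
  case/andP=> /andP[/and5P[BK _ bB _ _] ->] /andP[dP dQ].
  have cBK := cK BK bB dQ; have [+ _] := Kc cBK (setU11 _ _).
  by rewrite !inE => ->; rewrite cBK disjoint_setU1 cP dP.
have av2 : contr a v2 = wedge c p.
  by rewrite contr_wedge contr_wedge_neq // ap raddf0 oppr0 raddf0 subr0.
have cv2 : contr c (contr a v2) = p by rewrite av2 contr_wedge cp raddf0 subr0.
have pv2 : contr c (wedge c (contr a v2)) = 0 by rewrite av2 wedge_wedge raddf0.
have phiv2 : phi v2 = 0.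
  by rewrite /phi pv2 (contr_wedge_neq _ ca) raddfN /= wedge_wedge oppr0 raddf0 addr0.
pose z2 := z1 + bd v2.
have hz2 : chain_in (layer K n.+1) z2 by apply: chain_inD => //; apply: chain_in_bd.
have dz2 : bd z2 = 0 by rewrite raddfD /= dz1 bd_bd addr0.
have phiz2 : phi z2 = 0.
  by rewrite phiD phiz1 add0r -[phi _]opprK -bd_phi phiv2 raddf0 oppr0.
have p2 : contr c (wedge c (contr a z2)) = 0.
  have LD u u' : contr c (wedge c (contr a (u + u'))) =
      contr c (wedge c (contr a u)) + contr c (wedge c (contr a u')).
    by rewrite !raddfD.
  have := bd_contr_wedge c a v2; rewrite LD -/p pv2 raddf0 cv2 => /eqP.
  by rewrite eq_sym -opprD oppr_eq0 => /eqP.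
have q2 : contr a (wedge a (contr c z2)) = 0.
  by move: phiz2; rewrite /phi p2 add0r.
(* The faces containing both [a] and [c] go as well, because [z2] is a cycle. What is left misses
   [a] and [c] and is coned off from [b]. *)
have r2 : contr c (contr a z2) = 0.
  have := bd_contr_wedge c a z2; rewrite p2 raddf0 dz2 !(raddf0, subr0).
  by move/eqP; rewrite eq_sym oppr_eq0 => /eqP.
have hz2' : chain_in [set B in layer K n.+1 | (a \notin B) && (c \notin B)] z2.
  move=> B zB; rewrite inE (hz2 _ zB) /=.
  have [aB|aB] := boolP (a \in B); have [cB|cB] := boolP (c \in B) => //=.
  - have := contr_neq0 (x := c) _ (contr_neq0 aB zB).
    by rewrite r2 ffunE eqxx !inE ca cB => /(_ isT).
  - have := contr_neq0 aB zB; have := contr_wedgeE c (contr a z2) (B :\ a).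
    by rewrite p2 ffunE !inE (negbTE cB) andbF => <-; rewrite eqxx.
  - have := contr_neq0 cB zB; have := contr_wedgeE a (contr c z2) (B :\ c).
    by rewrite q2 ffunE !inE (negbTE aB) andbF => <-; rewrite eqxx.
exists (- v - v2 + wedge b z2).
  apply: chain_inD; first by apply: chain_inB => //; apply: chain_inN.
  apply: chain_in_wedge hz2' => B bB; rewrite !inE cardsU1 bB add1n eqSS.
  by case/andP=> /andP[BK ->] /andP[aB cB]; rewrite bK.
rewrite raddfD raddfB raddfN /= bd_wedge dz2 raddf0 subr0 /z2 /z1.
by rewrite addrC -opprD -[X in X - _]addrA addrK.
Qed.

End Reduction.
End PathReduction.

(** * Complexes with few vertices *)

Local Notation toQ := (intmul (1 : rat)).

(** If [c] lies in the rational row space of [A], then [c] times the rational pseudo-inverse of [A]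
    is a preimage of [c]; [m] clears all denominators of that pseudo-inverse, independently of
    [c]. *)
Lemma int_cokernel_torsion (p q : nat) (A : 'M[int]_(p, q)) :
  exists2 m : nat, (0 < m)%N & forall (c : 'rV_q) (b : 'rV_p) (k : nat), (0 < k)%N ->
    b *m A = c *+ k -> exists b' : 'rV_p, b' *m A = c *+ m.
Proof.
pose P := pinvmx (map_mx toQ A).
pose m := (\prod_i \prod_j `|denq (P i j)|)%N.
have m0 : (0 < m)%N.
  by apply: prodn_gt0 => i; apply: prodn_gt0 => j; rewrite absz_gt0 denq_neq0.
have /fin_all_exists[f hf] : forall i, exists r : 'rV[int]_p,
    forall j, toQ (r 0 j) = P i j * m%:R.
  move=> i; have /fin_all_exists[g hg] : forall j, exists z : int, toQ z = P i j * m%:R.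
    move=> j; have /dvdnP[d md] : (`|denq (P i j)| %| m)%N.
      by rewrite /m (bigD1 i) //= (bigD1 j) //= -mulnA dvdn_mulr.
    exists (numq (P i j) * d%:Z); rewrite intrM md natrM.
    by rewrite numqE -[in LHS]absz_denq -!pmulrn; ring.
  by exists (\row_j g j) => j; rewrite mxE hg.
exists m => // c b k k0 e; exists (c *m \matrix_i f i).
suff /matrixP h : map_mx toQ (c *m \matrix_i f i *m A) = map_mx toQ (c *+ m).
  by apply/matrixP=> i j; move: (h i j); rewrite mxE [in RHS]mxE => /intr_inj.
rewrite !map_mxM -scaler_nat.
have -> : map_mx toQ (\matrix_i f i) = m%:R *: P.
  by apply/matrixP=> i j; rewrite 2!mxE hf [RHS]mxE mulrC.
have cA : (map_mx toQ c <= map_mx toQ A)%MS.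
  have := congr1 (map_mx toQ) e; rewrite map_mxM raddfMn /= -scaler_nat => e'.
  have k1 : k%:R != 0 :> rat by rewrite pnatr_eq0 -lt0n.
  by rewrite -[map_mx toQ c](scalerK k1) -e' scalemx_sub // submxMl.
rewrite -scalemxAr -scalemxAl (mulmxKpV cA).
by rewrite map_mxZ /= rmorph_nat.
Qed.

Lemma mulmxMnl (p q r : nat) (u : 'M[int]_(p, q)) (A : 'M[int]_(q, r)) n :
  u *+ n *m A = (u *m A) *+ n.
Proof. exact: (raddfMn (mulmxr A)). Qed.

Lemma sign_matrix_torsion (N : nat) : exists2 m : nat, (0 < m)%N &
  forall (p : nat) (A : 'M[int]_p), (p <= N)%N -> (forall i j, A i j \in [:: -1; 0; 1]) ->
  forall (c : 'rV_p) (b : 'rV_p) (k : nat), (0 < k)%N ->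
    b *m A = c *+ k -> exists b' : 'rV_p, b' *m A = c *+ m.
Proof.
(* Coding the entries -1, 0, 1 in ['I_3] makes the sign matrices of a given size a finite type, over
   which the constants can be multiplied. *)
pose Z p (A : 'M['I_3]_p) : 'M[int]_p := map_mx (fun i : 'I_3 => (i : nat)%:Z - 1) A.
have /fin_all_exists2[f f0 hf] : forall p : 'I_N.+1, exists2 m : nat, (0 < m)%N &
    forall (A : 'M['I_3]_p) (c : 'rV_p) (b : 'rV_p) (k : nat), (0 < k)%N ->
    b *m Z p A = c *+ k -> exists b' : 'rV_p, b' *m Z p A = c *+ m.
  move=> p; have /fin_all_exists2[f f0 hf] := fun A => int_cokernel_torsion (Z p A).
  exists (\prod_A f A)%N; first by apply: prodn_gt0.
  move=> A c b k k0 e; have [b' e'] := hf A c b k k0 e.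
  exists (b' *+ (\prod_(B | B != A) f B)%N).
  by rewrite mulmxMnl e' [in RHS](bigD1 A) //= mulrnA.
exists (\prod_p f p)%N; first by apply: prodn_gt0.
move=> p A pN hA c b k k0; pose p' : 'I_N.+1 := Ordinal (pN : (p < N.+1)%N).
pose A' : 'M['I_3]_p := \matrix_(i, j) inord (absz (A i j + 1)).
have -> : A = Z p A'.
  apply/matrixP=> i j; rewrite !mxE; have := hA i j; rewrite !inE.
  by case/or3P=> /eqP-> /=; rewrite inordK.
move=> e; have [b' e'] := hf p' A' c b k k0 e.
exists (b' *+ (\prod_(q | q != p') f q)%N).
by rewrite mulmxMnl e' [in RHS](bigD1 p') //= mulrnA.
Qed.

Lemma torsion_bound_bounded (N : nat) : exists2 m : nat, (0 < m)%N &
  forall (T : finType) (K : {set {set T}}) (L : {set T}) n,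
    down_closed K -> (forall B, B \in K -> B \subset L) -> (#|L| <= N)%N ->
  torsion_bound K n m.
Proof.
have [m m0 hm] := sign_matrix_torsion (2 ^ N); exists m => // T K L n Kdown KL LN.
pose coef (A B : {set T}) : int :=
  \sum_(x | (x \notin B) && (x |: B == A)) boundary_sign B x.
have coef_sign A B : coef A B \in [:: -1; 0; 1].
  rewrite /coef; have [/existsP[x /andP[xB /eqP xA]]|/existsPn h] :=
      boolP [exists x, (x \notin B) && (x |: B == A)]; last first.
    by rewrite big_pred0 // => x; apply/negbTE/h.
  rewrite (big_pred1 x) => [|y].
    by rewrite /boundary_sign -signr_odd; case: odd.
  rewrite -{}xA /=; apply/andP/eqP=> [[yB /eqP/setP/(_ y)]|-> //].
  by rewrite !inE eqxx (negbTE yB) !orbF => /esym/eqP.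
have bdE (b : {ffun {set T} -> int}) B : bd b B = \sum_A coef A B * b A.
  rewrite /bd sum_ffunE; apply: esym; under eq_bigr => A _ do rewrite mulr_suml.
  rewrite (exchange_big_dep (fun x => x \notin B)) /= => [|A x _ /andP[] //].
  rewrite big_mkcond; apply: eq_bigr => x _; rewrite ffunE; case: (boolP (x \in B)) => //= xB.
  by rewrite (big_pred1 (x |: B)) // => A; rewrite eq_sym.
move=> c b k k0 hc hb e.
pose E (i : 'I_#|powerset L|) : {set T} := enum_val i.
(* Padding with zero rows makes the boundary matrix square, of size at most [2 ^ N] whatever [T],
   [K] and [n] are. *)
pose M := \matrix_(i, j) (if E i \in layer K n.+1 then coef (E i) (E j) else 0).
have bdM (u : {ffun {set T} -> int}) (v : 'rV_#|powerset L|) j :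
    chain_in (layer K n.+1) u -> (forall i, E i \in layer K n.+1 -> v 0 i = u (E i)) ->
    (v *m M) 0 j = bd u (E j).
  move=> hu hv; rewrite bdE mxE (bigID (mem (powerset L))) /= [X in _ + X]big1.
    rewrite addr0 [RHS]big_enum_val; apply: eq_bigr => i _; rewrite mxE.
    case: ifPn => [/hv->|h]; first by rewrite mulrC.
    by rewrite (chain_in_eq0 hu h) !mulr0.
  move=> A AL; rewrite (chain_in_eq0 hu) ?mulr0 // inE; apply: contra AL.
  by case/andP=> /KL; rewrite inE.
pose row (u : {ffun {set T} -> int}) := \row_i u (E i).
have hM i j : M i j \in [:: -1; 0; 1].
  by rewrite mxE; case: ifP => // _; apply: coef_sign.
have pN : (#|powerset L| <= 2 ^ N)%N by rewrite card_powerset leq_pexp2l.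
have eM : row b *m M = row c *+ k.
  apply/rowP=> j; rewrite (bdM b) // => [|i _]; last by rewrite mxE.
  by rewrite e ffunMnE mulmxnE mxE.
have [v hv] := hm _ M pN hM _ _ _ k0 eM.
pose b' := [ffun A => if A \in layer K n.+1 then
  \sum_(i | E i == A) v 0 i else 0] : {ffun {set T} -> int}.
have hb' : chain_in (layer K n.+1) b'.
  by move=> A; rewrite ffunE; case: ifP; rewrite ?eqxx.
exists b' => //; apply/ffunP=> B; rewrite ffunMnE.
have [BL|BL] := boolP (B \in powerset L).
  have EB : E (enum_rank_in BL B) = B by rewrite /E enum_rankK_in.
  rewrite -EB -(bdM b' v) // => [|i iK]; first by rewrite hv mulmxnE mxE.
  rewrite ffunE iK (big_pred1 i) // => i'; exact: (inj_eq enum_val_inj).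
have BK : B \notin layer K n.
  by apply: contra BL; rewrite !inE => /andP[/KL].
by rewrite (chain_in_eq0 (chain_in_bd Kdown hb') BK) (chain_in_eq0 hc BK) mul0rn.
Qed.

(** * Matching complexes of sparse graphs *)

Section GraphComplexes.
Variables (T V : finType).
Implicit Types (d : T -> {set V}) (A B L D : {set T}) (K : {set {set T}}).

Definition touch d e f := ~~ [disjoint d e & d f].

Definition matching d B := {in B &, forall e f, touch d e f -> e = f}.

Definition endpoints d A := \bigcup_(e in A) d e.

(* The faces are matchings, and any further constraint on them involves only  *)
(* the edges in D.                                                             *)
Record graph_complex d L D g M K : Prop := GraphComplex {
  gc_down : down_closed K;
  gc_face : forall B, B \in K <-> [/\ B \subset L, matching d B & B :&: D \in K];
  gc_sparse : forall A, A \subset L -> (#|A| <= #|endpoints d A| + g)%N;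
  gc_ends : forall e, e \in L -> #|d e| = 2%N;
  gc_special : (#|D| <= M)%N }.

Lemma touchP d e f : reflect (exists2 v, v \in d e & v \in d f) (touch d e f).
Proof.
rewrite /touch -setI_eq0.
by apply: (iffP (set0Pn _)) => [[v /setIP[]]|[v ve vf]]; exists v => //; apply/setIP.
Qed.

Lemma touchC d e f : touch d e f = touch d f e.
Proof. by rewrite /touch disjoint_sym. Qed.

Lemma matchingS d A B : B \subset A -> matching d A -> matching d B.
Proof. by move=> /subsetP sBA h e f /sBA eA /sBA fA; apply: h. Qed.

Lemma matchingU1 d e B : matching d B ->
  (forall f, f \in B -> touch d e f -> f = e) -> matching d (e |: B).
Proof.
move=> mB h f f'; rewrite !inE => /predU1P[->|fB] /predU1P[->|f'B] // t.
- by rewrite (h f').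
- by rewrite (h f) // touchC.
- exact: mB t.
Qed.

Section Complex.
Variables (d : T -> {set V}) (L D : {set T}) (g M : nat) (K : {set {set T}}).
Hypothesis gc : graph_complex d L D g M K.

Lemma gc_sub B : B \in K -> B \subset L.
Proof. by case/(gc_face gc). Qed.

Lemma gc_matching B : B \in K -> matching d B.
Proof. by case/(gc_face gc). Qed.

Lemma touchxx e : e \in L -> touch d e e.
Proof.
move=> eL; have : (0 < #|d e|)%N by rewrite (gc_ends gc).
by case/card_gt0P=> v ve; apply/touchP; exists v.
Qed.

Lemma gc_add e B : B \in K -> e \in L -> e \notin D ->
  (forall f, f \in B -> touch d e f -> f = e) -> e |: B \in K.
Proof.
move=> BK eL eD h; have [BL mB BD] := iffLR (gc_face gc B) BK.
apply/(gc_face gc); split; first by rewrite subUset sub1set eL.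
  exact: matchingU1.
rewrite setIUl; have -> : [set e] :&: D = set0; last by rewrite set0U.
by apply/setP=> f; rewrite !inE; case: eqP => // ->; apply/negbTE.
Qed.

(** Sparsity is hereditary, and the further constraint on a face of the link still involves only its
    edges in [D], so [D], [g] and [M] are unchanged. *)
Lemma link_graph_complex f : f \in L ->
  graph_complex d [set e in L | ~~ touch d e f] D g M (link K f).
Proof.
move=> fL; split.
- exact/link_down_closed/(gc_down gc).
- move=> B; split=> [BK|[BL mB BD]].
    have := BK; rewrite inE => /andP[fB fBK]; split.
    + apply/subsetP=> e eB; rewrite inE (subsetP (gc_sub fBK)) ?inE ?eB ?orbT //=.
      apply/negP => t; have ef : e = f.
        by apply: (gc_matching fBK) => //; rewrite !inE ?eqxx ?eB ?orbT.
      by rewrite -ef eB in fB.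
    + by apply: matchingS (gc_matching fBK); apply: subsetUr.
    + by apply: (link_down_closed (gc_down gc)) BK; apply: subsetIl.
  have notouch e : e \in B -> ~~ touch d e f.
    by move/(subsetP BL); rewrite inE => /andP[].
  have fB : f \notin B by apply/negP => /notouch; rewrite touchxx.
  move: BD; rewrite !inE (negbTE fB) /= => fBD; apply/(gc_face gc); split.
  + rewrite subUset sub1set fL; apply: subset_trans BL _.
    by apply/subsetP=> e; rewrite inE => /andP[].
  + by apply: matchingU1 => // e /notouch; rewrite touchC => /negbTE->.
  + by apply: (gc_down gc) fBD; rewrite setIUl; apply: setSU; apply: subsetIl.
- move=> A AL; apply: (gc_sparse gc); apply: subset_trans AL _.
  by apply/subsetP=> e; rewrite inE => /andP[].
- by move=> e; rewrite inE => /andP[/(gc_ends gc)].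
- exact: gc_special gc.
Qed.

Lemma torsion_bound_clique n m b : b \in L -> b \notin D ->
    {in L &, forall e f, e != b -> f != b -> touch d e b -> touch d f b -> touch d e f} ->
    (forall f, f \in L -> torsion_bound (link K f) n m) ->
  torsion_bound K n.+1 m.
Proof.
move=> bL bD cl hm; pose F := [set e in L | (e != b) && touch d e b].
apply: (torsion_bound_cone (gc_down gc) (F := F) (a := b)).
- move=> B e f BK; rewrite !inE => /and3P[eL eb te] /and3P[fL fb tf] eB fB.
  by apply: (gc_matching BK) => //; apply: cl.
- move=> B BK dB; apply: gc_add => // f fB; rewrite touchC => t.
  apply/eqP; apply: contraTT dB => fb; apply/pred0Pn; exists f; apply/andP.
  by rewrite !inE fB fb t (subsetP (gc_sub BK)).
- by move=> f; rewrite inE => /andP[/hm].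
Qed.

Section Path.
Variables (a b c : T) (p q r s : V).
Hypotheses (aL : a \in L) (bL : b \in L) (cL : c \in L).
Hypotheses (aD : a \notin D) (bD : b \notin D) (cD : c \notin D).
Hypotheses (ab : a != b) (cb : c != b) (ac : a != c) (pq : p != q).
Hypotheses (da : d a = [set p; r]) (db : d b = [set r; s]) (dc : d c = [set q; s]).
Hypothesis at_r : forall e, e \in L -> r \in d e -> e = a \/ e = b.
Hypothesis at_s : forall e, e \in L -> s \in d e -> e = c \/ e = b.

Local Notation P := [set e in L | (p \in d e) && (e != a)].
Local Notation Q := [set e in L | (q \in d e) && (e != c)].
Local Notation K' := (path_contraction K a b c P Q).

Let ps : p != s.
Proof.
apply/eqP=> ps; have sa : s \in d a by rewrite da ps !inE eqxx.
by have [/eqP|/eqP] := at_s aL sa; rewrite ?(negbTE ac) ?(negbTE ab).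
Qed.

Lemma torsion_bound_subdivided n m : torsion_bound K' n m -> torsion_bound K n.+1 m.
Proof.
have inL B e : B \in K -> e \in B -> e \in L by move=> /gc_sub /subsetP; apply.
have Kno B e f v : B \in K -> e \in B -> v \in d e -> v \in d f -> e != f -> f \notin B.
  move=> BK eB ve vf; apply: contraNN => fB; apply/eqP.
  by apply: (gc_matching BK) => //; apply/touchP; exists v.
have ar : r \in d a by rewrite da !inE eqxx orbT.
have ap : p \in d a by rewrite da !inE eqxx.
have cs : s \in d c by rewrite dc !inE eqxx orbT.
have cq : q \in d c by rewrite dc !inE eqxx.
have br : r \in d b by rewrite db !inE eqxx.
have bs : s \in d b by rewrite db !inE eqxx orbT.
apply: torsion_bound_path => //; first exact: gc_down gc.
- by rewrite !inE cL dc !inE (negbTE pq) (negbTE ps).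
- move=> B BK aB; split; first exact: (Kno _ a _ r).
  rewrite disjoint_subset; apply/subsetP=> e eB; rewrite !inE.
  apply/and3P=> -[_ pe ea].
  by have := Kno B e a p BK eB pe ap ea; rewrite aB.
- move=> B BK cB; split; first exact: (Kno _ c _ s).
  rewrite disjoint_subset; apply/subsetP=> e eB; rewrite !inE.
  apply/and3P=> -[_ pe ea].
  by have := Kno B e c q BK eB pe cq ea; rewrite cB.
- move=> B BK bB /pred0P dB; apply: gc_add => // f fB /touchP[v].
  rewrite da !inE => /orP[]/eqP-> vf.
    by apply/eqP; have := dB f; rewrite !inE /= fB vf (inL _ _ BK fB) /= => /negbFE.
  by have [//|fb] := at_r (inL _ _ BK fB) vf; rewrite -fb fB in bB.
- move=> B BK bB /pred0P dB; apply: gc_add => // f fB /touchP[v].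
  rewrite dc !inE => /orP[]/eqP-> vf.
    by apply/eqP; have := dB f; rewrite !inE /= fB vf (inL _ _ BK fB) /= => /negbFE.
  by have [//|fb] := at_s (inL _ _ BK fB) vf; rewrite -fb fB in bB.
- move=> B BK aB cB; apply: gc_add => // f fB /touchP[v].
  rewrite db !inE => /orP[]/eqP-> vf.
    by have [fa|//] := at_r (inL _ _ BK fB) vf; rewrite -fa fB in aB.
  by have [fc|//] := at_s (inL _ _ BK fB) vf; rewrite -fc fB in cB.
Qed.

Local Notation mu := (fun v => if v == q then p else v).

Let mu_eq v w : mu v = mu w -> v = w \/ (v = p /\ w = q) \/ (v = q /\ w = p).
Proof.
by move=> /=; case: eqP => [->|_]; case: eqP => [->|_] e; auto.
Qed.

Let mu_pq : mu p = mu q.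
Proof. by rewrite /= eqxx (negbTE pq). Qed.

(* The contraction merges p and q; edges joining p to q would become loops and *)
(* are removed.                                                                *)
Lemma path_graph_complex : graph_complex (fun e => mu @: d e)
  [set e in L | (e \notin [set a; b; c]) && ~~ ((p \in d e) && (q \in d e))] D g M K'.
Proof.
set L' := [set e in L | _].
have LL' A : A \subset L' -> A \subset L.
  by move=> h; apply: subset_trans h _; apply/subsetP=> e; rewrite inE => /andP[].
have notabc e : e \in L' -> [/\ e != a, e != b & e != c].
  by rewrite !inE !negb_or -!andbA => /and5P[].
have notpq e : e \in L' -> p \in d e -> q \in d e -> False.
  by rewrite inE => /and3P[_ _ h] h1 h2; rewrite h1 h2 in h.
have K'down : down_closed K'.
  move=> A B sBA; rewrite !inE => /and5P[AK aA bA cA dA].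
  have nB x : x \notin A -> x \notin B by apply: contra; apply: (subsetP sBA).
  rewrite (gc_down gc sBA AK) !nB //=.
  by case/orP: dA => dA; rewrite (disjointWl sBA dA) ?orbT.
split=> //.
- move=> B; split=> [BK'|[BL' mB BD]].
    have /setIdP[BK /and4P[aB bB cB dPQ]] := BK'.
    (* Missing [P] or missing [Q] says that no edge at [p] coexists with an edge at [q]; this is
       what being a matching demands once [p] and [q] are merged. *)
    have notPQ e f : e \in B -> f \in B -> p \in d e -> q \in d f -> False.
      move=> eB fB pe qf; case/orP: dPQ => /pred0P.
        move/(_ e); rewrite !inE /= eB pe (subsetP (gc_sub BK)) //=.
        by move/negbFE/eqP=> ea; rewrite -ea eB in aB.
      move/(_ f); rewrite !inE /= fB qf (subsetP (gc_sub BK)) //=.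
      by move/negbFE/eqP=> fc; rewrite -fc fB in cB.
    split.
    + apply/subsetP=> e eB; rewrite !inE (subsetP (gc_sub BK)) //= !negb_or.
      apply/andP; split; last by apply/andP => -[]; apply: notPQ.
      by apply/andP; split; first (apply/andP; split);
        apply: contraTneq eB => ->.
    + move=> e f eB fB /touchP[_ /imsetP[v ve ->] /imsetP[w wf]].
      case/mu_eq=> [vw|[[vp wq]|[vq wp]]].
      * by apply: (gc_matching BK) => //; apply/touchP; exists v; rewrite // vw.
      * by case: (notPQ e f eB fB); rewrite -?vp -?wq.
      * by case: (notPQ f e fB eB); rewrite -?vq -?wp.
    + by apply: K'down BK'; apply: subsetIl.
  have mB' : matching d B.
    move=> e f eB fB /touchP[v ve vf]; apply: mB => //.
    by apply/touchP; exists (mu v); apply: imset_f.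
  have BK : B \in K.
    apply/(gc_face gc); split=> //; first exact: LL'.
    by move: BD; rewrite inE => /andP[].
  have nB x : x \notin L' -> x \notin B by apply: contra; apply: (subsetP BL').
  rewrite inE BK !nB ?inE ?eqxx ?orbT ?andbF //=.
  apply/negPn/negP; rewrite negb_or.
  move=> /andP[/pred0Pn[e /andP[/= eB eP]] /pred0Pn[f /andP[/= fB fQ]]].
  move: eP fQ; rewrite !inE => /and3P[_ pe _] /and3P[_ qf _].
  have ef : e = f.
    by apply: mB => //; apply/touchP; exists (mu p); [|rewrite mu_pq]; apply: imset_f.
  by apply: (notpq e); rewrite ?(subsetP BL') // ef.
- move=> A AL'; have -> : endpoints (fun e => mu @: d e) A = mu @: endpoints d A.
    apply/setP=> v; apply/bigcupP/imsetP => [[e eA /imsetP[w we ->]]|[w /bigcupP[e eA we] ->]].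
      by exists w => //; apply/bigcupP; exists e.
    by exists e => //; apply: imset_f.
  have [/andP[pA qA]|npq] := boolP ((p \in endpoints d A) && (q \in endpoints d A)); last first.
    rewrite card_in_imset; first exact/(gc_sparse gc)/LL'.
    move=> v w vA wA /mu_eq[//|[[vp wq]|[vq wp]]].
      by rewrite -vp vA -wq wA in npq.
    by rewrite -wp wA -vq vA in npq.
  (* If [A] meets both [p] and [q], adding the removed path gives three edges but at most the two
     new vertices [r] and [s]. The unit gained in the sparsity bound pays for the vertex lost by
     merging. *)
  pose A' := a |: (b |: (c |: A)).
  have cA' : #|A'| = (#|A| + 3)%N.
    have nA x : x \notin L' -> x \notin A by apply: contra; apply: (subsetP AL').
    rewrite !cardsU1 !inE (negbTE ab) (negbTE ac) eq_sym (negbTE cb) /=.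
    by rewrite !nA ?inE ?eqxx ?orbT ?andbF //= !add1n addn3.
  have sA' : A' \subset L.
    by rewrite !subUset !sub1set aL bL cL LL'.
  have h1 := gc_sparse gc sA'.
  have h2 : endpoints d A' \subset r |: (s |: endpoints d A).
    apply/subsetP=> v /bigcupP[e]; rewrite !inE => /or4P[/eqP->|/eqP->|/eqP->|eA].
    + by rewrite da !inE => /orP[]/eqP->; rewrite ?eqxx ?pA ?orbT.
    + by rewrite db !inE => /orP[]/eqP->; rewrite ?eqxx ?orbT.
    + by rewrite dc !inE => /orP[]/eqP->; rewrite ?eqxx ?qA ?orbT.
    + by move=> ve; rewrite (_ : v \in endpoints d A) ?orbT //; apply/bigcupP; exists e.
  have h3 : endpoints d A :\ q \subset mu @: endpoints d A.
    apply/subsetP=> v; rewrite !inE => /andP[vq vA]; apply/imsetP; exists v => //.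
    by rewrite (negbTE vq).
  have := subset_leq_card h2; have := subset_leq_card h3; have := cardsD1 q (endpoints d A).
  rewrite cA' in h1; rewrite !cardsU1 qA; clear -h1; move: h1.
  by case: (_ \notin _); case: (_ \notin _) => /=; lia.
- move=> e eL'; rewrite card_in_imset.
    by apply: (gc_ends gc); move: eL'; rewrite inE => /andP[].
  move=> v w vA wA /mu_eq[//|[[vp wq]|[vq wp]]].
    by case: (notpq e eL'); rewrite -?vp -?wq.
  by case: (notpq e eL'); rewrite -?vq -?wp.
- exact: gc_special gc.
Qed.

End Path.
End Complex.
End GraphComplexes.

Lemma graph_complex_le (T V : finType) (d : T -> {set V}) L D g g' M M' K :
  (g <= g')%N -> (M <= M')%N -> graph_complex d L D g M K -> graph_complex d L D g' M' K.
Proof.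
move=> gg MM [Kdown face sparse ends special]; split=> //; last exact: leq_trans MM.
by move=> A /sparse h; apply: leq_trans h _; rewrite leq_add2l.
Qed.

Lemma card_bigcup_le (I T : finType) (P : {set I}) (F : I -> {set T}) :
  (#|\bigcup_(i in P) F i| <= \sum_(i in P) #|F i|)%N.
Proof.
elim/big_rec2: _ => [|i n A _ h]; first by rewrite cards0.
by apply: leq_trans (leq_card_setU _ _) _; rewrite leq_add2l.
Qed.

(** * Irreducible graphs have boundedly many edges *)

Section DegreeCount.
Variables (T V : finType) (d : T -> {set V}) (L D : {set T}) (g M : nat).
Variable K : {set {set T}}.
Hypothesis gc : graph_complex d L D g M K.

Definition star v := [set e in L | v \in d e].

Let sum_star (B : {set T}) : B \subset L ->
  (\sum_(v in endpoints d L) #|star v :&: B| = 2 * #|B|)%N.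
Proof.
move=> BL; under eq_bigr => v _ do rewrite -sum1_card.
rewrite (exchange_big_dep (mem B)) /= => [|v e _]; last by rewrite inE => /andP[].
rewrite -sum1_card big_distrr /=; apply: eq_bigr => e eB.
rewrite muln1 -(gc_ends gc (subsetP BL _ eB)) -sum1_card.
apply: eq_bigl => v; rewrite !inE eB (subsetP BL _ eB) andbT /=.
by apply: andb_idl => ve; apply/bigcupP; exists e => //; apply: (subsetP BL).
Qed.

Let endpoints_special_le : (#|endpoints d (D :&: L)| <= 2 * M)%N.
Proof.
apply: leq_trans (card_bigcup_le _ _) _.
rewrite (eq_bigr (fun _ => 2%N)) => [|e /setIP[_ /(gc_ends gc)] //].
rewrite sum_nat_const mulnC leq_mul2l /=; apply: leq_trans (gc_special gc).
by apply: subset_leq_card; apply: subsetIl.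
Qed.

Lemma exists_reducible_edge : (6 * g + 11 * M < #|L|)%N ->
  exists b, [/\ b \in L, b \notin D &
    (exists2 r, r \in d b & #|star r| = 1%N) \/
    (forall r, r \in d b -> #|star r| = 2%N /\ star r :\ b \subset ~: D)].
Proof.
move=> big.
have [/existsP[b /and3P[bL bD h]]|/existsPn none] := boolP [exists b, [&& b \in L, b \notin D &
    [exists r in d b, #|star r| == 1%N] ||
    [forall r in d b, (#|star r| == 2%N) && (star r :\ b \subset ~: D)]]].
  exists b; split=> //; case/orP: h => [/existsP[r /andP[rb /eqP h]]|/forallP h].
    by left; exists r.
  by right=> r rb; have := h r; rewrite rb /= => /andP[/eqP].
have star_gt0 v : v \in endpoints d L -> (0 < #|star v|)%N.
  by case/bigcupP=> e eL ve; apply/card_gt0P; exists e; rewrite inE eL.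
pose leaves := [set v in endpoints d L | #|star v| == 1%N].
pose heavy := [set v in endpoints d L | (2 < #|star v|)%N].
pose light := [set v in endpoints d (D :&: L) | (#|star v| <= 2)%N].
have leaves_le : (#|leaves| <= 2 * M)%N.
  apply: leq_trans endpoints_special_le; apply: subset_leq_card; apply/subsetP=> v.
  rewrite inE => /andP[/bigcupP[e eL ve] v1]; apply/bigcupP; exists e => //.
  rewrite inE eL andbT; apply/negPn/negP => eD; have := none e.
  rewrite eL eD negb_or negb_exists /= => /andP[/forallP/(_ v)].
  by rewrite ve v1.
have heavy_le : (\sum_(v in heavy) #|star v| <= 6 * g + 6 * M)%N.
  (* This holds vertex by vertex, with k the degree: 6 <= 3k + 3 for k = 1, 6 <= 3k for k = 2, and k
     + 6 <= 3k for k >= 3. Sparsity and the bound on leaves then bound the total degree of the heavy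
     vertices. *)
  have h : (\sum_(v in heavy) #|star v| + 6 * #|endpoints d L| <=
            3 * (2 * #|L|) + 3 * #|leaves|)%N.
    have e1 : (\sum_(v in heavy) #|star v| =
        \sum_(v in endpoints d L) if (2 < #|star v|)%N then #|star v| else 0)%N.
      by rewrite -big_mkcondr; apply: eq_bigl => v; rewrite inE.
    have e2 : #|leaves| =
        (\sum_(v in endpoints d L) if #|star v| == 1%N then 1 else 0)%N.
      by rewrite -big_mkcondr -sum1_card; apply: eq_bigl => v; rewrite inE.
    have e3 : (2 * #|L| = \sum_(v in endpoints d L) #|star v|)%N.
      rewrite -(sum_star (subxx L)); apply: eq_bigr => v _; congr #|pred_of_set _|.
      by apply/setIidPl/subsetP=> e; rewrite inE => /andP[].
    rewrite e1 e2 e3 -sum1_card !big_distrr -!big_split /=.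
    apply: leq_sum => v /star_gt0 v0; case: ltnP; case: eqP; lia.
  have := gc_sparse gc (subxx L); lia.
have light_le : (#|\bigcup_(v in light) star v| <= 4 * M)%N.
  apply: leq_trans (card_bigcup_le _ _) _.
  have h v : v \in light -> (#|star v| <= 2)%N by rewrite inE => /andP[].
  apply: (@leq_trans (\sum_(v in light) 2)%N); first exact: leq_sum.
  rewrite sum_nat_const.
  have : (#|light| <= #|endpoints d (D :&: L)|)%N.
    by apply: subset_leq_card; apply/subsetP=> v; rewrite inE => /andP[].
  have := endpoints_special_le; lia.
(* An irreducible edge outside [D] has an endpoint that is heavy, or has degree 2 with its other
   edge in [D]. The three pieces have at most M, 6g + 6M and 4M edges. *)
have cover : L \subset D :|: (\bigcup_(v in heavy) star v :|: \bigcup_(v in light) star v).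
  apply/subsetP=> b bL; rewrite !inE; have [//|bD /=] := boolP (b \in D).
  have := none b; rewrite bL bD negb_or /= => /andP[/existsPn n1 /forallPn[r]].
  rewrite negb_imply => /andP[rb].
  have rL : r \in endpoints d L by apply/bigcupP; exists b.
  have bs : b \in star r by rewrite inE bL.
  have := n1 r; rewrite rb /= => r1 h.
  have [r2|r2] := leqP #|star r| 2; last first.
    by apply/orP; left; apply/bigcupP; exists r; rewrite // inE rL.
  have r2' : #|star r| == 2%N.
    by rewrite eqn_leq r2 ltn_neqAle eq_sym r1 star_gt0.
  move: h; rewrite r2' /= => /subsetPn[a]; rewrite !inE negbK => /and3P[_ aL ra] aD.
  apply/orP; right; apply/bigcupP; exists r => //; rewrite inE r2 andbT.
  by apply/bigcupP; exists a => //; rewrite inE aD.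
set H := \bigcup_(v in heavy) _ in cover; set C := \bigcup_(v in light) _ in cover light_le.
have H_le : (#|H| <= 6 * g + 6 * M)%N.
  by apply: leq_trans heavy_le; apply: card_bigcup_le.
have := leq_trans (subset_leq_card cover) (leq_card_setU D (H :|: C)).
have := (leq_card_setU H C).1; have := gc_special gc; lia.
Qed.

End DegreeCount.

(** * Induction on the homological degree *)

Lemma torsion_bound_graph_complex (n g M : nat) : exists2 m : nat, (0 < m)%N &
  forall (T V : finType) (d : T -> {set V}) L D K,
    graph_complex d L D g M K -> torsion_bound K n m.
Proof.
elim: n => [|n [m m0 IH]].
  by exists 1%N => // T V d L D K gc; apply: torsion_bound0; apply: gc_down gc.
have [m' m'0 hm'] := torsion_bound_bounded (6 * g + 11 * M).
exists (m * m')%N; first by rewrite muln_gt0 m0.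
move=> T V d L D K gc; have [small|big] := leqP #|L| (6 * g + 11 * M).
  apply: (torsion_bound_dvd (dvdn_mull _ (dvdnn m'))).
  by apply: hm' (gc_down gc) _ small => B /(gc_sub gc).
apply: (torsion_bound_dvd (dvdn_mulr _ (dvdnn m))).
have IHlink f : f \in L -> torsion_bound (link K f) n m.
  by move=> fL; apply: IH (link_graph_complex gc fL).
have [b [bL bD hb]] := exists_reducible_edge gc big.
have starP v e : reflect (e \in L /\ v \in d e) (e \in star d L v).
  by rewrite inE; apply: andP.
have [r [s [rs db]]] : exists r s, r != s /\ d b = [set r; s].
  exact/cards2P/eqP/(gc_ends gc).
case: hb => [[v vb /eqP/cards1P[b' sv]]|h].
  have vonly e : e \in L -> v \in d e -> e = b.
    move=> eL ve; have : e \in star d L v by apply/starP.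
    have : b \in star d L v by apply/starP.
    by rewrite sv !inE => /eqP-> /eqP->.
  (* With [v] a leaf, all neighbours of [b] pass through its other endpoint, hence touch one
     another. *)
  apply: (torsion_bound_clique gc bL bD _ IHlink) => e f eL fL eb fb.
  move=> /touchP[w we wb] /touchP[u uf ub]; apply/touchP.
  exists w => //; suff -> : w = u by [].
  have wv : w != v by apply: contraNneq eb => wv; apply/eqP/vonly; rewrite // -wv.
  have uv : u != v by apply: contraNneq fb => uv; apply/eqP/vonly; rewrite // -uv.
  move: vb wb ub wv uv; rewrite db !inE.
  by case/orP=> /eqP-> /orP[]/eqP-> /orP[]/eqP->; rewrite ?eqxx.
have other v : v \in d b -> exists a, [/\ a \in L, a \notin D, a != b &
    v \in d a /\ forall e, e \in L -> v \in d e -> e = a \/ e = b].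
  move=> vb; have [c2 sD] := h v vb; have bs : b \in star d L v by apply/starP.
  have /cards1P[a sa] : #|star d L v :\ b| == 1%N.
    by move: c2; rewrite (cardsD1 b) bs add1n => -[->].
  have : a \in star d L v :\ b by rewrite sa inE.
  move=> as_; have := subsetP sD _ as_; rewrite inE => aD.
  move: as_; rewrite in_setD1 => /andP[ab /starP[aL va]].
  exists a; split=> //; split=> // e eL ve.
  have [->|eb] := eqVneq e b; [by right | left; apply/set1P; rewrite -sa].
  by rewrite in_setD1 eb; apply/starP.
have [rb sb] : r \in d b /\ s \in d b by rewrite db !inE !eqxx orbT.
have [a [aL aD ab [ra at_r]]] := other r rb.
have [c [cL cD cb [sc at_s]]] := other s sb.
have second e v : e \in L -> v \in d e -> exists2 w, w != v & d e = [set w; v].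
  move=> eL ve; have /eqP/cards2P[x [y [xy de]]] := gc_ends gc eL.
  move: ve; rewrite de !inE => /orP[]/eqP->; last by exists x.
  by exists y; rewrite 1?eq_sym // setUC.
have [p pr da] := second a r aL ra; have [q qs dc] := second c s cL sc.
(* If [a] and [c] touch, possibly because they coincide, they are pairwise touching neighbours of
   [b]; otherwise [a], [b], [c] form a path with distinct ends that can be contracted. *)
have [tac|tac] := boolP (touch d a c).
  apply: (torsion_bound_clique gc bL bD _ IHlink) => e f eL fL eb fb.
  have nb x : x \in L -> x != b -> touch d x b -> x = a \/ x = c.
    move=> xL /eqP xb /touchP[w wx]; rewrite db !inE => /orP[]/eqP wE; subst w.
      by have [|//] := at_r x xL wx; left.
    by have [|//] := at_s x xL wx; right.
  move=> /(nb _ eL eb)[]-> /(nb _ fL fb)[]-> //; rewrite 1?touchC //.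
    exact: touchxx gc _ aL.
  exact: touchxx gc _ cL.
have ac : a != c by apply: contraNneq tac => <-; apply: touchxx gc _ aL.
have pq : p != q.
  apply: contraNneq tac => pq; apply/touchP; exists p.
    by rewrite da !inE eqxx.
  by rewrite dc pq !inE eqxx.
apply: (torsion_bound_subdivided gc aL bL cL aD bD cD ab cb ac pq da db dc at_r at_s).
exact: IH (path_graph_complex gc aL bL cL ab cb ac pq da db dc).
Qed.

(** * Multipaths as matchings without circulations *)

Section MultipathCharacterization.
Variable G : quiver.
Implicit Types (A C : {set edge G}) (e f : edge G) (p q : seq (edge G)).

(* A nonempty union of vertex-disjoint directed cycles. *)
Definition circulation C := [&& C != set0, dinjectiveb (@source G) C,
  dinjectiveb (@target G) C & [set source e | e in C] == [set target e | e in C]].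

Lemma closed_path_balanced e q f :
    path [rel e1 e2 | source e2 == target e1] e q ->
    target f = source e -> source f = target (last e q) ->
  [set source x | x in f :: e :: q] = [set target x | x in f :: e :: q].
Proof.
move=> pq tf sf.
have sq : map (@source G) q = map (@target G) (belast e q).
  elim: q e pq {tf sf} => //= x q IH e /andP[/eqP xe xq].
  by rewrite xe (IH x xq).
have tq v : (v \in target e :: map (@target G) q) =
    (v == target (last e q)) || (v \in map (@target G) (belast e q)).
  by rewrite -map_cons lastI map_rcons mem_rcons inE.
have perm : map (@source G) (f :: e :: q) =i map (@target G) (f :: e :: q).
  by move=> v; rewrite /= inE [in RHS]inE tq inE sq sf tf orbCA.
apply/setP=> v; apply/imsetP/imsetP => -[x xp ->].
  have : source x \in map (@target G) (f :: e :: q) by rewrite -perm map_f.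
  by case/mapP=> y yp ->; exists y.
have : target x \in map (@source G) (f :: e :: q) by rewrite perm map_f.
by case/mapP=> y yp ->; exists y.
Qed.

Lemma multipath_path A e : is_multipath A -> e \in A ->
  exists p, [/\ is_simple_path_seq p, e \in p, {subset p <= A} &
    forall f x, f \in A -> x \in p -> source f \in [:: source x; target x] \/
      target f \in [:: source x; target x] -> f \in p].
Proof.
move=> mA eA; have eC : e \in component_edges A (source e) by rewrite !inE eA connect0.
have C0 : component_edges A (source e) != set0 by apply/set0Pn; exists e.
move/forallP/(_ (source e)): mA; rewrite (negbTE C0) andbF /=.
case/(component_simple_pathP C0) => p pC sp; exists p; split=> //; first by rewrite pC.
  by move=> x; rewrite pC inE => /andP[].
move=> f x fA; rewrite !pC => xC h; apply: component_edgeP => //.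
have sx : source x \in component_vertices A (source e) by move: xC; rewrite inE => /andP[].
have tx := component_target xC.
apply/orP; move: sx tx; rewrite ![_ \in component_vertices _ _]inE => sx tx.
by case: h; rewrite !inE => /orP[]/eqP->; auto.
Qed.

Lemma multipath_source_inj A : is_multipath A -> {in A &, injective (@source G)}.
Proof.
move=> mA e f eA fA sef; have [p [sp ep _ pc]] := multipath_path mA eA.
have fp : f \in p by apply: (pc f e) => //; left; rewrite sef !inE eqxx.
have [_ us _ _] := iffLR (simple_path_seqP e p) sp.
apply/eqP; apply: contraTT us => ef; apply/negP => us; case/eqP: ef.
move: sef; rewrite -{1}(nth_index e ep) -{1}(nth_index e fp) => /eqP.
rewrite -!(nth_map e (source e)) ?index_mem // nth_uniq ?size_map ?index_mem //.
by move=> /eqP h; rewrite -(nth_index e ep) h nth_index.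
Qed.

Lemma multipath_target_inj A : is_multipath A -> {in A &, injective (@target G)}.
Proof.
move=> mA e f eA fA sef; have [p [sp ep _ pc]] := multipath_path mA eA.
have fp : f \in p by apply: (pc f e) => //; right; rewrite sef !inE eqxx orbT.
have [_ _ us _] := iffLR (simple_path_seqP e p) sp.
apply/eqP; apply: contraTT us => ef; apply/negP => us; case/eqP: ef.
move: sef; rewrite -{1}(nth_index e ep) -{1}(nth_index e fp) => /eqP.
rewrite -!(nth_map e (target e)) ?index_mem // nth_uniq ?size_map ?index_mem //.
by move=> /eqP h; rewrite -(nth_index e ep) h nth_index.
Qed.

(** In a circulation every edge has a predecessor, whereas walking backwards along a simple path
    must stop at its first edge. *)
Lemma multipath_no_circulation A C : is_multipath A -> C \subset A -> ~~ circulation C.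
Proof.
move=> mA CA; apply/negP => /and4P[/set0Pn[e eC] _ _ /eqP st].
have [p [sp ep pA pc]] := multipath_path mA (subsetP CA _ eC).
have [_ _ _ h] := iffLR (simple_path_seqP e p) sp.
suff noC i : (i < size p)%N -> nth e p i \notin C.
  by have := noC (index e p); rewrite index_mem nth_index // eC => /(_ ep).
elim/ltn_ind: i => i IH ip; apply/negP => iC.
have : source (nth e p i) \in [set target e | e in C] by rewrite -st imset_f.
case/imsetP=> f fC sf.
have fp : f \in p.
  apply: (pc f (nth e p i)); rewrite ?mem_nth ?(subsetP CA) //.
  by right; rewrite -sf !inE eqxx.
have jp : (index f p < size p)%N by rewrite index_mem.
have ij : i = (index f p).+1 by apply/(h _ _ ip jp); rewrite nth_index.
by have := IH (index f p); rewrite ij ltnSn nth_index // fC => /(_ isT jp).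
Qed.

(** For the converse, take a longest simple path in a component. An edge of [A] continuing it at
    either end would lengthen it or close it into a circulation, so the path absorbs every edge
    touching it and fills the component. *)
Lemma multipathP A : is_multipath A <-> [/\ {in A &, injective (@source G)},
  {in A &, injective (@target G)} & forall C, C \subset A -> ~~ circulation C].
Proof.
split=> [mA|[sI tI noC]].
  split; [exact: multipath_source_inj | exact: multipath_target_inj |].
  by move=> C; apply: multipath_no_circulation.
apply/forallP=> v; set CE := component_edges A v.
have [C0|C0] := eqVneq CE set0; first by rewrite component_vertices1 // eqxx.
apply/orP; right; apply/(component_simple_pathP C0).
have CEA e : e \in CE -> e \in A by rewrite inE => /andP[].
have nobal (p : seq (edge G)) : {subset p <= A} -> p != [::] ->
    [set source x | x in p] = [set target x | x in p] -> False.
  case: p => // e p pA _ st; have CA : [set x in e :: p] \subset A.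
    by apply/subsetP=> x; rewrite inE => /pA.
  have := noC _ CA; rewrite /circulation => /negP; apply; apply/and4P; split.
  - by apply/set0Pn; exists e; rewrite !inE eqxx.
  - by apply/dinjectiveP => x y; rewrite !inE => /pA xA /pA yA; apply: sI.
  - by apply/dinjectiveP => x y; rewrite !inE => /pA xA /pA yA; apply: tI.
  have E (F : edge G -> vertex G) : [set F x | x in [set x in e :: p]] = [set F x | x in e :: p].
    by apply/setP=> w; apply/imsetP/imsetP => -[x xp ->]; exists x; rewrite ?inE in xp *.
  by rewrite !E st.
pose isP (p : seq (edge G)) := is_simple_path_seq p && all (mem CE) p.
pose good n := [exists p : n.-tuple (edge G), isP p].
have goodI p : isP p -> good (size p) by move=> h; apply/existsP; exists (in_tuple p).
have exg : exists n, good n.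
  (* A single edge is a simple path unless it is a loop, and a loop is a circulation. *)
  case/set0Pn: C0 => e eC; exists 1%N; apply: (goodI [:: e]).
  rewrite /isP /= eC !andbT; apply/eqP => se.
  apply: (nobal [:: e]) => // [x|]; first by rewrite inE => /eqP->; apply: CEA.
  by apply/setP=> w; apply/imsetP/imsetP => -[x]; rewrite inE => /eqP-> ->;
     exists e; rewrite ?inE.
have ubg n : good n -> (n <= #|edge G|)%N.
  case/existsP=> p /andP[sp _]; rewrite -(size_tuple p).
  have up : uniq p by case: (tval p) sp => // e q /and4P[_ /map_uniq].
  by rewrite -(card_uniqP up) max_card.
case: (ex_maxnP exg ubg) => n /existsP[p /andP[sp /allP pC]] nmax.
have longer q : isP q -> (size q <= size p)%N by move/goodI/nmax; rewrite size_tuple.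
case: (tval p) sp pC longer => {p} // e q sp pC longer.
have {}pC : {subset e :: q <= CE} by [].
have sC : source e \in component_vertices A v.
  by have := pC e (mem_head _ _); rewrite inE => /andP[].
have /and4P[pq us ut st] := sp.
have pA : {subset e :: q <= A} by move=> x /pC /CEA.
have ext f (F : edge G -> vertex G) : {in A &, injective F} -> f \in A ->
    f \notin e :: q -> F f \notin map F (e :: q).
  move=> FI fA fp; apply: contra fp => /mapP[x xp Fx].
  by rewrite (FI _ _ fA (pA _ xp) Fx).
have nobalf f : f \in A -> target f = source e -> source f = target (last e q) -> False.
  move=> fA tf sf; apply: (nobal (f :: e :: q)) => //.
    by move=> x; rewrite inE => /predU1P[->|/pA].
  exact: closed_path_balanced.
have [p0 _ _ h] := iffLR (simple_path_seqP e (e :: q)) sp.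
have source_in f : f \in A -> source f = target (last e q) -> f \in e :: q.
  move=> fA sf; apply/negPn/negP => fp; suff /longer : isP (rcons (e :: q) f).
    by rewrite size_rcons ltnn.
  rewrite /isP all_rcons; apply/andP; split; last first.
    apply/andP; split; last exact/allP.
    apply: component_edgeP => //.
    by rewrite sf (component_target (pC _ (mem_last e q))) orbT.
  rewrite rcons_cons; apply/and4P; split.
  - by rewrite rcons_path pq /= sf eqxx.
  - by rewrite -rcons_cons map_rcons rcons_uniq us ext.
  - by rewrite -rcons_cons map_rcons rcons_uniq ut ext.
  - by rewrite last_rcons; apply/eqP => tf; apply: (nobalf f).
have target_in f : f \in A -> target f = source e -> f \in e :: q.
  move=> fA tf; apply/negPn/negP => fp; suff /longer : isP (f :: e :: q).
    by rewrite /= ltnn.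
  rewrite /isP; apply/andP; split; last first.
    apply/allP => x; rewrite inE => /predU1P[->|/pC //].
    by apply: component_edgeP => //; rewrite tf sC.
  apply/and4P; split=> //=.
  - by rewrite tf eqxx.
  - by rewrite ext.
  - by rewrite ext.
  - by apply/eqP => sf; apply: (nobalf f).
have closed f x : f \in A -> x \in e :: q ->
    source f \in [:: source x; target x] \/ target f \in [:: source x; target x] ->
    f \in e :: q.
  move=> fA xp; set i := index x (e :: q).
  have ip : (i < size (e :: q))%N by rewrite index_mem.
  have ix : nth e (e :: q) i = x by rewrite nth_index.
  have mem2 (w x1 x2 : vertex G) : w \in [:: x1; x2] -> w = x1 \/ w = x2.
    by rewrite !inE => /orP[]/eqP; auto.
  case=> /mem2[] hf.
  - by rewrite (sI _ _ fA (pA _ xp) hf).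
  - have [i1|i1] := ltnP i.+1 (size (e :: q)).
      have := iffRL (h _ _ i1 ip) erefl; rewrite ix -hf => /(sI _ _ (pA _ (mem_nth _ i1)) fA) <-.
      exact: mem_nth.
    apply: source_in => //; rewrite hf (last_nth e) -ix; congr (target (nth _ _ _)).
    by apply/eqP; rewrite eqn_leq -ltnS ip -ltnS.
  - case: (posnP i) => [i0|ipos].
      by apply: target_in => //; rewrite hf -ix i0.
    have jp : (i.-1 < size (e :: q))%N by apply: leq_ltn_trans ip; apply: leq_pred.
    have := iffRL (h i i.-1 ip jp); rewrite prednK // ix -hf => /(_ erefl).
    by move/(tI _ _ fA (pA _ (mem_nth _ jp))) ->; apply: mem_nth.
  - by rewrite (tI _ _ fA (pA _ xp) hf).
exists (e :: q) => // f; apply/idP/idP => [|fC]; first exact: pC.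
pose S w := exists2 x, x \in e :: q & w \in [:: source x; target x].
have Sclosed w u : adjacent A w u -> S w -> S u.
  move=> /adjacentP[y yA hy] [x xp wx].
  have yp : y \in e :: q.
    by apply: (closed y x) => //; case: hy => -[h1 h2]; [left; rewrite h1 | right; rewrite h2].
  exists y => //; case: hy => -[h1 h2]; first by rewrite -h2 !inE eqxx orbT.
  by rewrite -h1 !inE eqxx.
have [x xp sx] : S (source f).
  have : connect (adjacent A) (source e) (source f).
    have := pC e (mem_head _ _); move: fC; rewrite !inE => /andP[_ h1] /andP[_ h2].
    by apply: connect_trans h1; rewrite connect_adjacent_sym.
  have : S (source e) by exists e; rewrite ?inE eqxx.
  move: (source e) (source f) => w u Sw /connectP[l hl ->].
  by elim: l w Sw hl => //= z l IH w Sw /andP[wz]; apply/IH/(Sclosed w).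
by apply: (closed f x) (CEA _ fC) xp _; left.
Qed.

End MultipathCharacterization.

(** * Consequences of the genus bound *)

Lemma mxrank_sum_le (F : fieldType) (I : finType) (P : {pred I}) p q
    (M : I -> 'M[F]_(p, q)) :
  (\rank (\sum_(i in P) M i)%R <= \sum_(i in P) \rank (M i))%N.
Proof.
elim/big_rec2: _ => [|i n A _ h]; first by rewrite mxrank0.
by apply: leq_trans (mxrank_add _ _) _; rewrite leq_add2l.
Qed.

(** [M] is a sum of rank-one matrices, one for each column in [J] and one for each row outside
    [I]. *)
Lemma mxrank_le_support (F : fieldType) p q (M : 'M[F]_(p, q)) (I : {set 'I_p}) (J : {set 'I_q}) :
  (forall i j, i \in I -> j \notin J -> M i j = 0) -> (\rank M <= #|J| + #|~: I|)%N.
Proof.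
move=> M0; pose M' := \matrix_(i, j) (if j \in J then 0 else M i j).
have -> : M = \sum_(j in J) col j M *m (delta_mx 0 j : 'rV_q)
            + \sum_(i in ~: I) (delta_mx i 0 : 'cV_p) *m row i M'.
  apply/matrixP=> i j; rewrite mxE !summxE.
  have e1 k : (col k M *m (delta_mx 0 k : 'rV_q)) i j = if j == k then M i k else 0.
    by rewrite mxE big_ord1 !mxE eqxx /=; case: eqP; rewrite ?mulr1 ?mulr0.
  have e2 k : ((delta_mx k 0 : 'cV_p) *m row k M') i j = if i == k then M' k j else 0.
    by rewrite mxE big_ord1 !mxE eqxx andbT; case: eqP; rewrite ?mul1r ?mul0r.
  under eq_bigr => k _ do rewrite e1; under [X in _ + X]eq_bigr => k _ do rewrite e2.
  rewrite -!big_mkcondr /=.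
  have [jJ|jJ] := boolP (j \in J).
    rewrite (big_pred1 j) => [|k]; last by rewrite /= [j == k]eq_sym andb_idl // => /eqP->.
    by rewrite big1 ?addr0 // => k /andP[_ /eqP<-]; rewrite mxE jJ.
  rewrite big_pred0 ?add0r => [|k]; last by apply/andP => -[kJ /eqP jk]; rewrite jk kJ in jJ.
  have [iI|iI] := boolP (i \in I).
    rewrite big_pred0 ?M0 // => k; apply/andP => -[+ /eqP ik].
    by rewrite -ik inE iI.
  rewrite (big_pred1 i) => [|k]; first by rewrite mxE (negbTE jJ).
  by rewrite /= [i == k]eq_sym andb_idl // => /eqP->; rewrite inE.
apply: leq_trans (mxrank_add _ _) _; apply: leq_add; apply: leq_trans (mxrank_sum_le _ _) _.
  by rewrite -sum1_card; apply: leq_sum => j _; apply: mulmx_max_rank.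
by rewrite -sum1_card; apply: leq_sum => j _; apply: mulmx_max_rank.
Qed.

Section QuiverGenus.
Variable G : quiver.
Implicit Types (A C : {set edge G}).

(** The rows of the boundary matrix indexed by [A] are supported on the endpoints of [A], which
    bounds the rank from above and so the genus, the dimension of the kernel, from below. *)
Lemma genus_sparse A :
  (#|A| <= #|[set source e | e in A] :|: [set target e | e in A]| + genus G)%N.
Proof.
set W := _ :|: _.
have rI (T : finType) (S : {set T}) x : (enum_val x \in S) = (x \in [set enum_rank y | y in S]).
  by rewrite -{2}[x]enum_valK mem_imset //; apply: enum_rank_inj.
have /mxrank_le_support : forall i j, i \in [set enum_rank e | e in A] ->
    j \notin [set enum_rank w | w in W] -> cellular_boundary G i j = 0.
  move=> i j; rewrite -!rI => eA jW; rewrite mxE.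
  have h (v : vertex G) : v \in W -> (v == enum_val j) = false.
    by move=> vW; apply: contraNF jW => /eqP<-.
  by rewrite !h ?subrr // !inE imset_f ?orbT.
have := rank_leq_row (cellular_boundary G).
have cI (T : finType) (S : {set T}) : #|[set enum_rank y | y in S]| = #|S|.
  by apply: card_imset; apply: enum_rank_inj.
have : (#|~: [set enum_rank e | e in A]| + #|A| = #|edge G|)%N.
  by rewrite -(cI _ A) addnC cardsC card_ord.
by rewrite /genus mxrank_ker !cI; move: (\rank _) #|~: _| => k l <-; lia.
Qed.

Definition indicator C : 'rV[rat]_#|edge G| := \row_i (enum_val i \in C)%:R.

Lemma indicator_circulation C : circulation C -> (indicator C <= kermx (cellular_boundary G))%MS.
Proof.
case/and4P=> _ /dinjectiveP sI /dinjectiveP tI /eqP st; apply/sub_kermxP/rowP => j.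
rewrite !mxE.
transitivity (\sum_(e in C) ((target e == enum_val j)%:R - (source e == enum_val j)%:R) : rat).
  rewrite [RHS]big_mkcond /= (reindex (@enum_rank (edge G))) /=; last first.
    by exists enum_val => e _; rewrite ?enum_rankK ?enum_valK.
  by apply: eq_bigr => e _; rewrite !mxE enum_rankK; case: ifP => _; rewrite ?mul1r ?mul0r.
rewrite sumrB -(big_imset (fun v => (v == enum_val j)%:R) tI) /=.
by rewrite -(big_imset (fun v => (v == enum_val j)%:R) sI) /= st subrr.
Qed.

(** Indicators of circulations are 0-1 vectors in the cycle space, and suitably chosen coordinates,
    as many as the genus, determine a vector of that space. *)
Lemma card_circulations : (#|[set C | @circulation G C]| <= 2 ^ genus G)%N.
Proof.
pose W := row_base (kermx (cellular_boundary G)).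
have Wfull : row_full W^T by rewrite /row_full mxrank_tr; apply: row_base_free.
pose f := fullrankfun Wfull.
pose F C : {set 'I_(genus G)} := [set k | enum_val (f k) \in C].
have Finj : {in [set C | circulation C] &, injective F}.
  move=> C C'; rewrite !inE => /indicator_circulation hC /indicator_circulation hC' FF.
  have [x hx] : exists x, indicator C - indicator C' = x *m W.
    by apply/submxP; rewrite eq_row_base addmx_sub ?eqmx_opp.
  have x0 : x *m (rowsub f W^T)^T = 0.
    apply/rowP=> k; have := congr1 (fun u : 'rV_ _ => u 0 (f k)) hx.
    rewrite !mxE; have /setP/(_ k) := FF; rewrite !inE => ->; rewrite subrr => e.
    by rewrite [RHS]e; apply: eq_bigr => l _; rewrite !mxE.
  have xx : x = 0.
    have u : (rowsub f W^T)^T \in unitmx by rewrite unitmx_tr fullrowsub_unit.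
    by rewrite -(mulmxK u x) x0 mul0mx.
  apply/setP=> e; have := congr1 (fun u : 'rV_ _ => u 0 (enum_rank e)) hx.
  rewrite xx mul0mx !mxE enum_rankK => /eqP; rewrite subr_eq0 => /eqP.
  by case: (e \in C); case: (e \in C') => // /eqP; rewrite ?oner_eq0 // eq_sym oner_eq0.
rewrite -(card_in_imset Finj); apply: leq_trans (max_card _) _.
by rewrite -cardsT -powersetT card_powerset cardsT card_ord.
Qed.

End QuiverGenus.

(** * The multipath complex *)

Section MultipathComplex.
Variables (G : quiver) (n : nat).

Let ends (e : edge G) : {set vertex G + vertex G} := [set inl (source e); inr (target e)].

(* Larger circulations cannot lie in a face of cardinality at most n. *)
Let special : {set edge G} := \bigcup_(C in [set C | circulation C & (#|C| <= n)%N]) C.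

Let matchings : {set {set edge G}} :=
  [set B | `[< matching ends B >] && (B :&: special \in multipaths G)].

Let touch_ends e f : touch ends e f = (source e == source f) || (target e == target f).
Proof.
apply/touchP/orP => [[v]|[]/eqP h].
- rewrite !inE => /orP[]/eqP-> /orP[]/eqP; [| by []| by [] |].
    by case=> ->; left.
  by case=> ->; right.
- by exists (inl (source e)); rewrite !inE ?h eqxx.
- by exists (inr (target e)); rewrite !inE ?h eqxx orbT.
Qed.

Let matching_ends B : matching ends B <->
  {in B &, injective (@source G)} /\ {in B &, injective (@target G)}.
Proof.
split=> [mB|[sI tI] e f eB fB]; last first.
  by rewrite touch_ends => /orP[]/eqP; [apply: sI | apply: tI].
by split=> e f eB fB h; apply: mB => //; rewrite touch_ends h eqxx ?orbT.
Qed.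

Lemma matchings_graph_complex :
  graph_complex ends setT special (genus G) (2 ^ genus G * n) matchings.
Proof.
split.
- move=> A B sBA; rewrite !inE => /andP[/asboolP mA AX]; apply/andP; split.
    exact/asboolP/(matchingS sBA).
  by apply: is_multipathS AX; apply: setSI.
- move=> B; split=> [|[_ mB]].
    move=> BK; move: (BK); rewrite !inE => /andP[/asboolP mB BX]; split=> //.
    apply/andP; split; first by apply/asboolP; apply: matchingS mB; apply: subsetIl.
    by rewrite -setIA setIid.
  rewrite !inE -setIA setIid => /andP[_ ->]; rewrite andbT; exact/asboolP.
- move=> A _; apply: leq_trans (genus_sparse A) _; rewrite leq_add2r.
  (* Forgetting the splitting of vertices can only decrease their number, so sparsity passes from
     the quiver to the bipartite graph. *)
  pose p (v : vertex G + vertex G) := match v with inl w => w | inr w => w end.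
  apply: leq_trans (leq_imset_card p (endpoints ends A)).
  apply: subset_leq_card; apply/subsetP=> v; rewrite inE => /orP[]/imsetP[e eA ->].
    apply/imsetP; exists (inl (source e)) => //; apply/bigcupP; exists e => //.
    by rewrite !inE eqxx.
  apply/imsetP; exists (inr (target e)) => //; apply/bigcupP; exists e => //.
  by rewrite !inE eqxx orbT.
- by move=> e _; rewrite cards2.
- apply: leq_trans (card_bigcup_le _ _) _.
  apply: (@leq_trans (\sum_(C in [set C | @circulation G C & (#|C| <= n)%N]) n)%N).
    by apply: leq_sum => C; rewrite inE => /andP[].
  rewrite sum_nat_const leq_mul2r; apply/orP; right.
  apply: leq_trans (card_circulations G); apply: subset_leq_card.
  by apply/subsetP=> C; rewrite !inE => /andP[].
Qed.

(** A circulation inside a face of cardinality at most [n] has at most [n] edges, so it lies in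
    [special], where the multipath condition excludes it. *)
Lemma layer_matchings k : (k <= n)%N -> layer matchings k = layer (multipaths G) k.
Proof.
move=> kn; apply/setP=> B; rewrite !inE; case: eqP => cB; rewrite ?andbF // !andbT.
apply/idP/idP => [/andP[/asboolP/matching_ends[sI tI] /multipathP[_ _ noC]]|mB].
  apply/multipathP; split=> // C CB; apply/negP => circC.
  have CD : C \subset B :&: special.
    rewrite subsetI CB; apply: (bigcup_sup C) => //.
    by rewrite inE circC (leq_trans (subset_leq_card CB)) // cB.
  by have := noC C CD; rewrite circC.
have [sI tI _] := iffLR (multipathP B) mB.
rewrite (is_multipathS (subsetIl _ _) mB) andbT.
by apply/asboolP/matching_ends.
Qed.

End MultipathComplex.

(** * From the cokernel of [bd] to simplicial homology *)

Section HomologyTorsion.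
Variables (T : finType) (X : simplicial_complex T) (k : nat).

Let faces_down : down_closed (faces X).
Proof. by move=> A B; apply: facesS. Qed.

Let extend j (c : chain X j) : {ffun {set T} -> int} :=
  [ffun B => if insub B is Some s then c s else 0].

Let restrict j (c : {ffun {set T} -> int}) : chain X j := [ffun s => c (val s)].

Let extend_val j (c : chain X j) s : extend c (val s) = c s.
Proof. by rewrite ffunE valK. Qed.

Let restrictK j : cancel (@extend j) (@restrict j).
Proof. by move=> c; apply/ffunP=> s; rewrite ffunE extend_val. Qed.

Let extend_in j (c : chain X j) : chain_in (layer (faces X) j.+1) (extend c).
Proof. by move=> B; rewrite ffunE; case: insubP => [s h _|]; rewrite ?eqxx // inE. Qed.

Let boundary_restrict (b : {ffun {set T} -> int}) (s : simplex X k) :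
  chain_in (layer (faces X) k.+2) b -> boundary (restrict k.+1 b) s = bd b (val s).
Proof.
move=> hb; rewrite ffunE /bd sum_ffunE (exchange_big_dep xpredT) //=.
apply: eq_bigr => x _; rewrite ffunE.
have [xs|xs] := boolP (x \in val s).
  apply: big_pred0 => A; apply/andP => -[_ /eqP As].
  by move: xs; rewrite -(As : val A :\ x = val s) !inE eqxx.
have [AX|AX] := boolP (x |: val s \in layer (faces X) k.+2).
  have AX' : (x |: val s \in faces X) && (#|x |: val s| == k.+2) by rewrite inE in AX.
  rewrite (big_pred1 (Sub (x |: val s) AX' : simplex X k.+1)) => [|A].
    rewrite ffunE /= -boundary_sign_setD1 setU1K //.
  apply/andP/eqP => [[xA /eqP As]|->]; first by apply: val_inj; rewrite /= -As setD1K.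
  by rewrite /= setU11 setU1K.
rewrite (chain_in_eq0 hb AX) mulr0 big_pred0 // => A; apply/andP => -[xA /eqP As].
by case/negP: AX; rewrite -(As : val A :\ x = val s) setD1K // inE (valP A).
Qed.

(** Extension by zero identifies [k]-chains with chains on faces of cardinality [k.+1], whence the
    shift in degree. A multiple of a representing cycle bounds exactly when the same multiple of the
    class vanishes. *)
Lemma homology_annihilator m (x : homology X k) :
  torsion_bound (faces X) k.+1 m -> is_torsion x -> x *+ m = 0.
Proof.
move=> hm [n n0]; rewrite -[x]reprK; set z := repr x.
have piMn j : (\pi_(homology X k)%qT z *+ j == 0) = is_boundary (z *+ j).
  rewrite -raddfMn -(raddf0 (\pi_(homology X k)%qT)).
  have := Quotient.idealrBE (boundaries X k) (z *+ j) 0; rewrite subr0 => <-.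
  by [].
move=> /eqP; rewrite piMn => /asboolP[c hc]; apply/eqP; rewrite piMn; apply/asboolP.
have zMn j : (z *+ j : cycles X k) = (z : chain X k) *+ j :> chain X k.
  exact: (raddfMn (val : cycles X k -> chain X k)).
have hb : bd (extend c) = extend (z : chain X k) *+ n.
  apply/ffunP=> B; rewrite ffunMnE.
  have [BX|BX] := boolP (B \in layer (faces X) k.+1).
    have BX' : (B \in faces X) && (#|B| == k.+1) by rewrite inE in BX.
    have -> : B = val (Sub B BX' : simplex X k) by [].
    rewrite -boundary_restrict ?restrictK; last exact: (@extend_in _ _).
    by rewrite hc zMn extend_val ffunMnE.
  rewrite (chain_in_eq0 (chain_in_bd faces_down (@extend_in _ c)) BX).
  by rewrite (chain_in_eq0 (@extend_in _ _) BX) mul0rn.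
have [b' hb' e'] := hm _ _ _ n0 (@extend_in _ _) (@extend_in _ _) hb.
exists (restrict k.+1 b'); apply/ffunP=> s.
by rewrite boundary_restrict // e' ffunMnE extend_val zMn ffunMnE.
Qed.

End HomologyTorsion.

Theorem proposition4p7 (i g : nat) :
  exists m : int, m != 0 /\
    forall G : quiver, (genus G <= g)%N ->
    forall x : homology (multipath_complex G) i, is_torsion x -> x *~ m = 0.
Proof.
(* Degree [i] involves faces of cardinality [i.+1] and [i.+2] only. At most [2 ^ g] circulations of
   at most [i.+2] edges make up the special set. *)
have [m m0 hm] := torsion_bound_graph_complex i.+1 g (2 ^ g * i.+2).
exists m; split; first by rewrite -lt0n.
move=> G Gg x; apply: homology_annihilator.
have h := matchings_graph_complex G i.+2.
have gc : graph_complex _ _ _ g (2 ^ g * i.+2) _ :=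
  graph_complex_le Gg (leq_mul (leq_pexp2l (isT : 0 < 2)%N Gg) (leqnn _)) h.
move: (hm _ _ _ _ _ _ gc).
by rewrite /torsion_bound !layer_matchings.
Qed.
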